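(* Let $H:\mathbb R_+\to(0,1)$ be continuous and satisfy: (H1) there are constants $0<h_1<h_2<1$ with $h_1\le H_t\le h_2$ for all $t\ge0$; (H2) there are constants $D>0$, $\kappa\in(0,1]$ with $|H_t-H_s|\le D|t-s|^\kappa$ for all $t\ge s>0$; and assume $\min\{h_1,\kappa\}>1/2$. Let $Y$ be the multifractional Brownian motion with Hurst function $H$, $x_0\in\mathbb R$, and let $X$ be the (unique) solution of $X_t=x_0+\theta\int_0^tX_s\,ds+Y_t$, $t\ge0$, with $\theta>0$. Define \[ \hat\theta_T=\frac{\int_0^TX_s\,dX_s}{\int_0^TX_s^2\,ds}. \] Then $\hat\theta_T\to\theta$ almost surely as $T\to\infty$.
   Context: The (harmonizable) multifractional Brownian motion with continuous functional parameter $H$ is $Y(t)=\int_{\mathbb R}\frac{e^{itu}-1}{|u|^{H_t+1/2}}\widetilde W(du)$, $t\ge0$, where $\widetilde W$ is the Fourier transform of real Gaussian white noise $W$ (the unique complex-valued random measure with $\int f\,dW=\int\widehat f\,d\widetilde W$ a.s. for all $f\in L^2(\mathbb R)$). Under the assumptions, the trajectories of $Y$ and $X$ are a.s. Hölder continuous of every order less than $\min\{h_1,\kappa\}>1/2$ on bounded intervals, and $\int_0^TX_s\,dX_s$ is the pathwise (Riemann–Stieltjes/Young-type) integral, i.e. the a.s. limit of Riemann sums. *)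

(* Defs.v *)
From HB Require Import structures.
From mathcomp Require Import all_boot all_order all_algebra.
From mathcomp Require Import all_classical all_reals all_analysis.
Set Implicit Arguments. Unset Strict Implicit. Unset Printing Implicit Defensive.
Import Order.TTheory GRing.Theory Num.Theory.
Import numFieldNormedType.Exports.
Local Open Scope classical_set_scope.
Local Open Scope ring_scope.

(* Covariance of the harmonizable multifractional Brownian motion:
   E[Y_t Y_s] = (1/(2 pi)) \int_R (e^{itu}-1)(e^{-isu}-1) |u|^{-(H_t+H_s+1)} du,
   written with the real part of the integrand (the imaginary part is odd). *)
Definition mbm_cov {R : realType} (H : R -> R) (t s : R) : R :=
  (2 * pi)^-1 * Rintegral lebesgue_measure setT
    (fun u : R => ((cos (t * u) - 1) * (cos (s * u) - 1) + sin (t * u) * sin (s * u))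
                   * (`|u| `^ (- (H t + H s + 1)))).

Definition centered_gaussian_law {R : realType} (v : R) (A : set R) : \bar R :=
  if v == 0 then \d_(0:R) A else normal_prob 0 (Num.sqrt v) A.

Definition centered_gaussian_process {d} {Omega : measurableType d} {R : realType}
  (P : probability Omega R) (Y : R -> Omega -> R) (C : R -> R -> R) : Prop :=
  (forall t, measurable_fun setT (Y t)) /\
  forall (n : nat) (t : 'I_n -> R) (a : 'I_n -> R), (forall i, 0 <= t i) ->
    forall A : set R, measurable A ->
      P ((fun w => \sum_(i < n) a i * Y (t i) w) @^-1` A) =
      centered_gaussian_law (\sum_(i < n) \sum_(j < n) a i * a j * C (t i) (t j)) A.

Definition is_mbm {d} {Omega : measurableType d} {R : realType}
  (P : probability Omega R) (H : R -> R) (Y : R -> Omega -> R) : Prop :=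
  centered_gaussian_process P Y (mbm_cov H) /\
  {ae P, forall w, {within `[0, +oo[, continuous (fun t => Y t w)}}.

Definition RS_sum {R : realType} (f g : R -> R) (n : nat) (p xi : nat -> R) : R :=
  \sum_(i < n) f (xi i) * (g (p i.+1) - g (p i)).

Definition is_RS_integral {R : realType} (f g : R -> R) (a b I : R) : Prop :=
  forall eps : R, 0 < eps -> exists2 delta : R, 0 < delta &
    forall (n : nat) (p xi : nat -> R), p 0%N = a -> p n = b ->
      (forall i, (i < n)%N -> p i <= xi i <= p i.+1) ->
      (forall i, (i < n)%N -> p i.+1 - p i < delta) ->
      `|RS_sum f g n p xi - I| < eps.

(* Main.v *)
Require Import Defs.
From HB Require Import structures.
From mathcomp Require Import all_boot all_order all_algebra.
From mathcomp Require Import all_classical all_reals all_analysis.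
From mathcomp Require Import measurable_realfun ring lra.
Import Order.TTheory GRing.Theory Num.Theory.
Import numFieldNormedType.Exports.
Local Open Scope classical_set_scope.
Local Open Scope ring_scope.

(**
Put [J t = \int_0^t X], so that [J' = X = x0 + theta J + Y] and
[V t = exp (- theta t) J t] has derivative [exp (- theta t) (x0 + Y t)].

Paths.  Gaussian increments with [E (Y_t - Y_s)^2 <= (K (1 + s) |t - s|^a)^2],
[1/2 < a < min h1 kappa], and the Borel-Cantelli lemma bound almost surely all dyadic
increments of level [m >= m0], up to a time proportional to [m], by [q^m] with
[2^-a < q < 2^-1/2].  Chaining then gives both a Hoelder modulus of order larger than
[1/2] and the growth [|Y t| <= C exp (theta t / 2)].  The modulus makes quadratic variations
vanish, hence [\int_0^T X dX = (X_T^2 - X_0^2) / 2]; the growth makes [V] converge to some [l],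
[exp (- theta t) X t] converge to [theta l] and [exp (- 2 theta T) \int_0^T X^2] converge to
[(theta l)^2 / (2 theta)], so that the estimator tends to [theta] as soon as [l <> 0].

Non-degeneracy.  [l] is an iterated limit of Riemann sums [c + \sum_i c_i Y_(t_i)] with
[c_i >= 0].  The real part [cos (t u) - 1] of [exp (i t u) - 1] is nonpositive, so the
contributions to the variance of these sums cannot cancel: the variance is bounded below, the
probability of the event [|sum| < e] is [O(e)] uniformly, and [l = 0] has probability [0].
*)


Set Implicit Arguments. Unset Strict Implicit. Unset Printing Implicit Defensive.

(** * Antiderivatives on the half-line *)

Section antiderivatives.
Context {R : realType}.
Implicit Types (f g F G : R -> R).

(** The threshold is taken nonnegative so that facts known only on the half-line apply beyond it. *)
Lemma cvgryP f (l : R) : (f t @[t --> +oo] --> l) <->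
  forall e, 0 < e -> exists2 M, 0 <= M & forall t, M <= t -> `|f t - l| <= e.
Proof.
split=> [/cvgrPdist_le h e e0|h].
  have [M [Mr hM]] := h e e0.
  exists (Num.max 0 (M + 1)); first by rewrite le_max lexx.
  move=> t; rewrite ge_max => /andP[t0 Mt].
  by rewrite distrC hM//; apply: lt_le_trans Mt; rewrite ltrDl.
apply/cvgrPdist_le => e e0; have [M M0 hM] := h e e0.
exists M; split; first exact: num_real.
by move=> t Mt; rewrite distrC hM// ltW.
Qed.

(** At [0] only continuity is asked: the integral over [[0, t]], which vanishes for [t < 0], has in
    general no two-sided derivative there. *)
Definition antiderivative G g :=
  {within `[0, +oo[, continuous G} /\ forall t : R, 0 < t -> is_derive t 1 G (g t).

Lemma antiderivative_MVT G g (s t : R) : antiderivative G g -> 0 <= s -> s <= t ->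
  exists2 c, s <= c <= t & G t - G s = g c * (t - s).
Proof.
move=> [cG dG] s0; rewrite le_eqVlt => /predU1P[<-|st].
  by exists s; rewrite ?lexx// !subrr mulr0.
have [||c cst ->] := @MVT _ G g s t st.
- by move=> x; rewrite in_itv/= => /andP[sx _]; apply: dG; exact: le_lt_trans sx.
- apply: continuous_subspaceW cG => x; rewrite /= !in_itv/= andbT => /andP[sx _].
  exact: le_trans sx.
- by exists c => //; move: cst; rewrite in_itv/= => /andP[/ltW -> /ltW ->].
Qed.

Lemma antiderivative_homo G g (M s t : R) : antiderivative G g -> 0 <= M ->
  (forall x, M <= x -> 0 <= g x) -> M <= s -> s <= t -> G s <= G t.
Proof.
move=> GG M0 g0 Ms st.
have [c /andP[sc ct] GE] := antiderivative_MVT GG (le_trans M0 Ms) st.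
by rewrite -subr_ge0 GE mulr_ge0 ?subr_ge0// g0// (le_trans Ms).
Qed.

Lemma antiderivativeD F f G g : antiderivative F f -> antiderivative G g ->
  antiderivative (F \+ G) (f \+ g).
Proof.
move=> [cF dF] [cG dG]; split; first by move=> x; apply: cvgD; [exact: cF|exact: cG].
by move=> t t0; apply: is_deriveD; [exact: dF|exact: dG].
Qed.

Lemma antiderivativeZ k G g : antiderivative G g ->
  antiderivative (fun t => k * G t) (fun t => k * g t).
Proof.
move=> [cG dG]; split; first by move=> x; apply: cvgM; [exact: cvg_cst|exact: cG].
by move=> t t0; apply: is_deriveZ; exact: dG.
Qed.

Lemma antiderivativeM F f G g : antiderivative F f -> antiderivative G g ->
  antiderivative (fun t => F t * G t) (fun t => F t * g t + G t * f t).
Proof.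
move=> [cF dF] [cG dG]; split; first by move=> x; apply: cvgM; [exact: cF|exact: cG].
by move=> t t0; apply: is_deriveM; [exact: dF|exact: dG].
Qed.

Lemma continuous_expRM (c : R) : continuous (fun t => expR (c * t)).
Proof.
move=> x; apply: continuous_comp; last exact: continuous_expR.
by apply: cvgM; [exact: cvg_cst|exact: cvg_id].
Qed.

Lemma antiderivative_expR (c : R) :
  antiderivative (fun t => expR (c * t)) (fun t => c * expR (c * t)).
Proof.
split; first exact/continuous_subspaceT/continuous_expRM.
move=> t t0; have h : is_derive t (1 : R) (fun t : R => c * t : R) c.
  by apply: is_derive_eq; rewrite /GRing.scale/= mulr1.
have := @is_derive1_comp _ expR (fun t : R => c * t : R) t _ _ (is_derive_expR _) h.
by rewrite mulrC.
Qed.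

Lemma integrable_segment f (t : R) : {within `[0, +oo[, continuous f} ->
  lebesgue_measure.-integrable `[0, t] (EFin \o f).
Proof.
move=> cf; apply: continuous_compact_integrable; first exact: segment_compact.
apply: continuous_subspaceW cf => x; rewrite /= !in_itv/= andbT.
by case/andP.
Qed.

Lemma FTC_antiderivative f : {within `[0, +oo[, continuous f} ->
  antiderivative (fun t => Rintegral lebesgue_measure `[0, t] f) f.
Proof.
move=> cf; have if_ t := integrable_segment t cf.
have [cf0 _] := (continuous_within_itvcyP 0 f).1 cf.
have dJ (t : R) : 0 < t ->
    is_derive t 1 (fun t => Rintegral lebesgue_measure `[0, t] f) (f t).
  move=> t0; have [||dF FE] := @continuous_FTC1_closed _ f 0 t (t + 1) _ (if_ _) t0.
  - by rewrite ltrDl.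
  - by apply: cf0; rewrite in_itv/= t0.
  - by apply: DeriveDef; [exact: dF|rewrite -derive1E; exact: FE].
split=> //; apply/continuous_within_itvcyP; split.
  move=> t; rewrite in_itv/= andbT => t0.
  by apply/differentiable_continuous/derivable1_diffP; have [] := dJ t t0.
have := @parameterized_integral_continuous _ 0 1 f ler01 (if_ 1).
by move/(continuous_within_itvP _ ltr01) => [].
Qed.

Lemma Rintegral_segment0 f : Rintegral lebesgue_measure `[0, 0] f = 0.
Proof. by rewrite set_itv1 Rintegral_set1. Qed.

Lemma bounded_segment f (T : R) : {within `[0, +oo[, continuous f} -> 0 <= T ->
  exists2 M, 0 <= M & forall t, 0 <= t <= T -> `|f t| <= M.
Proof.
move=> cf T0; have cf' : {within `[0, T], continuous f}.
  by apply: continuous_subspaceW cf => x; rewrite /= !in_itv/= andbT => /andP[].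
have [c _ hc] := EVT_max T0 cf'; have [c' _ hc'] := EVT_min T0 cf'.
exists (`|f c| + `|f c'|) => [|t tT]; first exact: addr_ge0.
have {}tT : t \in `[0, T] by rewrite in_itv.
rewrite ler_norml; apply/andP; split.
  apply: le_trans (hc' t tT); rewrite lerNl.
  apply: (@le_trans _ _ `|f c'|); last by rewrite lerDr.
  by rewrite -normrN ler_norm.
apply: (le_trans (hc t tT)); apply: (@le_trans _ _ `|f c|); first exact: ler_norm.
by rewrite lerDl.
Qed.

Lemma expRN_cvg0 (c : R) : 0 < c -> expR (- c * t) @[t --> +oo] --> 0.
Proof.
move=> c0; apply/cvgryP => e e0; exists (e^-1 / c).
  by rewrite divr_ge0 ?invr_ge0 ?ltW.
move=> t; rewrite ler_pdivrMr// => h.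
rewrite subr0 ger0_norm ?expR_ge0// mulNr expRN -[leRHS]invrK lef_pV2 ?posrE ?expR_gt0 ?invr_gt0//.
rewrite (le_trans h)// mulrC; apply: le_trans (expR_ge1Dx _).
by rewrite lerDr.
Qed.

(* L'Hopital's rule for [G t / exp (c t)]. *)
Lemma antiderivative_cvg_expR G g (c l : R) : antiderivative G g -> 0 < c ->
  expR (- c * t) * g t @[t --> +oo] --> l ->
  expR (- c * t) * G t @[t --> +oo] --> l / c.
Proof.
move=> GG c0 /cvgryP h; apply/cvgryP => e e0.
have ec0 : 0 < e * c / 2 by rewrite !mulr_gt0// invr_gt0.
have [M M0 hM] := h _ ec0.
(* Past [M], [g] lies between [(l - e c / 2) exp (c t)] and [(l + e c / 2) exp (c t)]; subtracting
   from [G] primitives of these bounds gives functions that are monotone there. *)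
pose D k t := G t + (k / c) * expR (c * t).
have DD k : antiderivative (D k) (fun t => g t + (k / c) * (c * expR (c * t))).
  by apply: antiderivativeD => //; apply: antiderivativeZ; exact: antiderivative_expR.
have hg t : M <= t -> (l - e * c / 2) * expR (c * t) <= g t <= (l + e * c / 2) * expR (c * t).
  move=> /hM; rewrite ler_distl mulNr expRN [_ * g t]mulrC.
  by rewrite ler_pdivlMr ?expR_gt0// ler_pdivrMr ?expR_gt0.
have ub t : M <= t -> G t <= G M + (l + e * c / 2) / c * expR (c * t)
    - (l + e * c / 2) / c * expR (c * M).
  move=> Mt; have := antiderivative_homo (antiderivativeZ (-1) (DD (- (l + e * c / 2)))) M0 _ (lexx M) Mt.
  have p x : M <= x -> 0 <= -1 * (g x + - (l + e * c / 2) / c * (c * expR (c * x))).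
    move=> /hg/andP[_]; rewrite [_ / c * _]mulrA divfK ?gt_eqF//; lra.
  by move=> /(_ p); rewrite /D; lra.
have lb t : M <= t -> G M + (l - e * c / 2) / c * expR (c * t)
    - (l - e * c / 2) / c * expR (c * M) <= G t.
  move=> Mt; have := antiderivative_homo (DD (- (l - e * c / 2))) M0 _ (lexx M) Mt.
  have p x : M <= x -> 0 <= (g x + - (l - e * c / 2) / c * (c * expR (c * x))).
    move=> /hg/andP[+ _]; rewrite [_ / c * _]mulrA divfK ?gt_eqF//; lra.
  by move=> /(_ p); rewrite /D; lra.
(* [K] bounds both constants of integration; past [M'] the factor [exp (- c t)] reduces their
   contribution to at most [e / 2]. *)
pose K := `|G M - (l + e * c / 2) / c * expR (c * M)|
   + `|G M - (l - e * c / 2) / c * expR (c * M)|.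
have K0 : 0 <= K by rewrite addr_ge0.
have e1 : 0 < e / 2 / (K + 1) by rewrite !divr_gt0// ltr_wpDl.
have [M' M'0 hM'] := (cvgryP _ _).1 (expRN_cvg0 c0) _ e1.
exists (Num.max M M') => [|t]; first by rewrite le_max M0.
rewrite ge_max => /andP[Mt M't].
have {hM'} := hM' t M't; rewrite subr0 ger0_norm ?expR_ge0// ler_pdivlMr ?ltr_wpDl// => hE.
have {ub} := ub t Mt; have {lb} := lb t Mt.
set E := expR (- c * t) in hE *; have EE : expR (c * t) = E^-1 by rewrite /E mulNr expRN invrK.
have E0 : 0 < E by exact: expR_gt0.
rewrite EE => lb ub.
have k1 : G M - (l + e * c / 2) / c * expR (c * M) <= K.
  by rewrite (le_trans (ler_norm _))// lerDl.
have k2 : - K <= G M - (l - e * c / 2) / c * expR (c * M).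
  rewrite lerNl; apply: (@le_trans _ _ `|G M - (l - e * c / 2) / c * expR (c * M)|).
    by rewrite -normrN ler_norm.
  by rewrite lerDr.
have EK : E * K <= e / 2 by apply: le_trans hE; rewrite ler_pM2l// lerDl.
have u2 : E * G t <= E * K + (l + e * c / 2) / c.
  have : E * G t <= E * (K + (l + e * c / 2) / c / E) by rewrite ler_pM2l//; lra.
  by rewrite [in X in _ <= X]mulrDr [E * (_ / E)]mulrC divfK ?gt_eqF.
have l2 : - (E * K) + (l - e * c / 2) / c <= E * G t.
  have : E * (- K + (l - e * c / 2) / c / E) <= E * G t by rewrite ler_pM2l//; lra.
  suff -> : E * (- K + (l - e * c / 2) / c / E) = - (E * K) + (l - e * c / 2) / c by [].
  by rewrite mulrDr mulrN; congr (_ + _); rewrite mulrC divfK ?gt_eqF.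
have ce : e * c / 2 / c = e / 2 by field; rewrite gt_eqF.
rewrite ler_distl; apply/andP; split.
  by apply: le_trans l2; rewrite mulrBl ce; lra.
by apply: (le_trans u2); rewrite mulrDl ce; lra.
Qed.

(** Subtracting [(K / c) exp (- c t)] from [G] gives a nondecreasing function [N], adding it gives a
    nonincreasing function [N2], and [N <= N2]; so [N] has a limit, which is also that of [G]. *)
Lemma antiderivative_is_cvg G g (c K : R) : antiderivative G g -> 0 < c ->
  (forall t, 0 <= t -> `|g t| <= K * expR (- c * t)) ->
  exists l : R, G t @[t --> +oo] --> l.
Proof.
move=> GG c0 gK; pose N t := G t + (- (K / c)) * expR (- c * t).
have NN : antiderivative N (fun t => g t + (- (K / c)) * (- c * expR (- c * t))).
  by apply: antiderivativeD => //; apply: antiderivativeZ; exact: antiderivative_expR.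
have N'0 x : 0 <= x -> 0 <= g x + - (K / c) * (- c * expR (- c * x)).
  move=> /gK; rewrite ler_norml => /andP[].
  by rewrite [- (K / c) * _]mulrA mulrNN divfK ?gt_eqF//; lra.
(* Clamping the argument at [0] gives a function monotone on the whole line, as the monotone limit
   theorem requires. *)
pose N0 t := N (Num.max 0 t).
have homoN : {homo N0 : s t / s <= t}.
  move=> s t st; apply: (antiderivative_homo NN (lexx 0)) => //.
    by rewrite le_max lexx.
  by rewrite ge_max !le_max lexx/= st orbT.
pose N2 t := G t + (K / c) * expR (- c * t).
have NN2 : antiderivative N2 (fun t => g t + (K / c) * (- c * expR (- c * t))).
  by apply: antiderivativeD => //; apply: antiderivativeZ; exact: antiderivative_expR.
have N2'0 x : 0 <= x -> 0 <= -1 * (g x + (K / c) * (- c * expR (- c * x))).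
  move=> /gK; rewrite ler_norml => /andP[].
  by rewrite [K / c * _]mulrA [K / c * _]mulrN divfK ?gt_eqF//; lra.
have K0 : 0 <= K.
  by have := gK 0 (lexx 0); rewrite mulr0 expR0 mulr1; exact: le_trans.
have ubN : has_ubound (range N0).
  exists (N2 0) => _ [t _ <-]; rewrite /N0.
  have t0 : 0 <= Num.max 0 t by rewrite le_max lexx.
  have := antiderivative_homo (antiderivativeZ (-1) NN2) (lexx 0) N2'0 (lexx 0) t0.
  set u := Num.max 0 t; rewrite /N /N2 => h.
  have : 0 <= K / c * expR (- c * u) by rewrite mulr_ge0 ?divr_ge0 ?expR_ge0// ltW.
  by move: h; lra.
have := nondecreasing_cvgr homoN ubN; set l := sup _ => hl; exists l.
have : N0 t + (K / c) * expR (- c * t) @[t --> +oo] --> l + (K / c) * 0.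
  apply: cvgD => //; apply: cvgM; [exact: cvg_cst|exact: expRN_cvg0].
rewrite mulr0 addr0; apply: cvg_trans; apply: near_eq_cvg.
exists 0; split=> //= t t0; rewrite /N0 /N max_r ?ltW//; lra.
Qed.

End antiderivatives.

(** * Dyadic moduli and Riemann-Stieltjes integrals *)

Section dyadic_modulus.
Context {R : realType}.
Implicit Types (f g F G : R -> R) (q C T : R).

(* Hoelder continuity of order [- ln q / ln 2] on bounded intervals, without real powers. *)
Definition dyadic_modulus q f := forall T, 0 <= T -> exists (C : R) (m : nat),
  0 <= C /\ forall k s t, (m <= k)%N -> 0 <= s -> s <= t -> t <= T ->
    t - s <= 2^-1 ^+ k -> `|f t - f s| <= C * q ^+ k.

Lemma within_continuous_dist f (t e : R) : {within `[0, +oo[, continuous f} ->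
  0 <= t -> 0 < e ->
  exists2 d, 0 < d & forall s, 0 <= s -> `|s - t| < d -> `|f s - f t| <= e.
Proof.
move=> /continuous_within_itvcyP[cf cf0] t0 e0.
move: t0; rewrite le_eqVlt => /predU1P[<-|t0].
  have [d d0 hd] := (cvgrPdist_le _ _).1 cf0 e e0.
  exists d => // s; rewrite le_eqVlt => /predU1P[<-|s0]; first by move=> _; rewrite subrr normr0 ltW.
  by move=> sd; rewrite distrC; apply: hd => //=; rewrite distrC.
have ct : {for t, continuous f} by apply: cf; rewrite in_itv/= t0.
have [d d0 hd] := (cvgrPdist_le _ _).1 ct e e0.
by exists d => // s _ sd; rewrite distrC; apply: hd => //=; rewrite distrC.
Qed.

Lemma exprn_small (q : R) (e : R) : 0 <= q < 1 -> 0 < e ->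
  exists N, forall n, (N <= n)%N -> q ^+ n <= e.
Proof.
move=> /andP[q0 q1] e0.
have : q ^+ n @[n --> \oo] --> 0 by apply: cvg_expr; rewrite ger0_norm.
move/cvgrPdist_le => /(_ e e0)[N _ hN]; exists N => n Nn.
by have := hN n Nn; rewrite sub0r normrN ger0_norm ?exprn_ge0.
Qed.

(** The exponent is the least [j] with [2^-(j+1) <= l]; if it falls below [k], then [k] itself
    works. *)
Lemma dyadic_scale (l : R) (k : nat) : 0 < l -> l <= 2^-1 ^+ k ->
  exists2 j, (k <= j)%N & 2^-1 ^+ j.+1 <= l <= 2^-1 ^+ j.
Proof.
move=> l0 lk; have h2 : 0 <= (2^-1 : R) < 1 by lra.
have [N hN] := exprn_small h2 l0.
have ex : exists j, (2^-1 : R) ^+ j.+1 <= l by exists N; apply: hN.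
exists (maxn k (ex_minn ex)); first exact: leq_maxl.
case: ex_minnP => j jl jmin.
have [kj|jk] := leqP k j.
  rewrite jl/=; case: j jl jmin kj => [|j] jl jmin kj.
    by move: kj lk; rewrite leqn0 => /eqP ->.
  have [//|h] := leP l (2^-1 ^+ j.+1).
  by have := jmin j (ltW h); rewrite ltnn.
rewrite lk andbT; apply: le_trans jl; apply: ler_wiXn2l; [lra|lra|exact: ltnW].
Qed.

Lemma partition_bounds (p : nat -> R) n (b : R) :
  (forall i, (i < n)%N -> p i <= p i.+1) -> p n = b ->
  forall i, (i <= n)%N -> p 0%N <= p i <= b.
Proof.
move=> pm pn i; move=> i_n; apply/andP; split.
  elim: i i_n => // i IH i_n; apply: le_trans (pm _ i_n); apply: IH; exact: ltnW.
have h k : (i + k <= n)%N -> p i <= p (i + k)%N.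
  elim: k => [|k IH]; first by rewrite addn0.
  by rewrite addnS => ikn; apply: le_trans (pm _ ikn); apply: IH; exact: ltnW.
by rewrite -pn -(subnKC i_n); apply: h; rewrite subnKC.
Qed.

Lemma telescope_ord (p : nat -> R) n : \sum_(i < n) (p i.+1 - p i) = p n - p 0%N.
Proof. by rewrite -(big_mkord xpredT (fun i => p i.+1 - p i)) telescope_sumr. Qed.

(* On each piece, [f xi * (f b - f a)] differs from [(f b ^ 2 - f a ^ 2) / 2] by
   at most the square of the oscillation, which is [o(b - a)] as [2 q ^ 2 < 1]. *)
Lemma is_RS_integral_self f q T : 0 <= q -> 2 * q ^+ 2 < 1 -> 0 < T ->
  dyadic_modulus q f -> is_RS_integral f f 0 T ((f T ^+ 2 - f 0 ^+ 2) / 2).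
Proof.
move=> q0 q1 T0 /(_ T (ltW T0))[C [m [C0 fC]]] eps eps0.
have r01 : 0 <= 2 * q ^+ 2 < 1 by rewrite q1 mulr_ge0 ?exprn_ge0.
(* [r] is the gain per dyadic level: [(q^j)^2 = r^j 2^-j], and [2^-j] will be comparable to the
   length of a piece. *)
set r := 2 * q ^+ 2 in q1 r01.
have e1 : 0 < eps / (4 * (C ^+ 2 + 1) * T).
  by rewrite divr_gt0// !mulr_gt0// ltr_wpDl ?sqr_ge0.
have [N hN] := exprn_small r01 e1.
pose K := maxn m N; exists (2^-1 ^+ K); first by rewrite exprn_gt0// invr_gt0.
move=> n p xi p0 pn pxi pd.
have pm i : (i < n)%N -> p i <= p i.+1.
  by move=> /pxi/andP[]; exact: le_trans.
have pb := partition_bounds pm pn.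
have piece i : (i < n)%N -> `|f (xi i) * (f (p i.+1) - f (p i))
    - (f (p i.+1) ^+ 2 - f (p i) ^+ 2) / 2| <= 2 * C ^+ 2 * r ^+ K * (p i.+1 - p i).
  move=> i_n; have /andP[ax xb] := pxi i i_n.
  have /andP[a0 _] := pb i (ltnW i_n); have /andP[_ bT] := pb i.+1 i_n.
  rewrite p0 in a0; have ab := pm i i_n; have ld := pd i i_n.
  set a := p i in ax a0 ab ld *; set b := p i.+1 in xb bT ab ld *; set x := xi i in ax xb *.
  move: ab; rewrite le_eqVlt => /predU1P[ab|ab].
    have -> : x = a by apply/eqP; rewrite eq_le ax ab xb.
    by rewrite -ab !subrr !mulr0 mul0r subrr normr0.
  have l0 : 0 < b - a by rewrite subr_gt0.
  (* The level [j] is adapted to each piece, since pieces may be far shorter than the mesh bound. *)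
  have [j Kj /andP[lj jl]] := dyadic_scale l0 (ltW ld).
  have mj : (m <= j)%N by apply: leq_trans Kj; exact: leq_maxl.
  set D := C * q ^+ j.
  have D1 : `|f b - f a| <= D by apply: fC => //; exact: ltW.
  have D2 : `|f b - f x| <= D.
    by apply: fC => //; [exact: le_trans ax|lra].
  have D3 : `|f x - f a| <= D.
    by apply: fC => //; [exact: le_trans bT|lra].
  have -> : f x * (f b - f a) - (f b ^+ 2 - f a ^+ 2) / 2 =
     (f b - f a) * (((f x - f a) - (f b - f x)) / 2) by field.
  rewrite normrM; apply: (@le_trans _ _ (D * D)).
    apply: ler_pM => //; rewrite normrM (ger0_norm (_ : 0 <= 2^-1)) ?invr_ge0//.
    have := ler_normB (f x - f a) (f b - f x); lra.
  have -> : D * D = C ^+ 2 * r ^+ j * 2^-1 ^+ j.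
    have h2 : (2 : R) ^+ j * 2^-1 ^+ j = 1.
      by rewrite -exprMn mulfV ?pnatr_eq0// expr1n.
    have -> : r ^+ j = 2 ^+ j * (q ^+ j) ^+ 2 by rewrite /r exprMn -!exprM mulnC.
    transitivity (C ^+ 2 * (q ^+ j) ^+ 2 * (2 ^+ j * 2^-1 ^+ j)); last by ring.
    by rewrite h2 mulr1 /D; ring.
  have -> : 2 * C ^+ 2 * r ^+ K * (b - a) = C ^+ 2 * r ^+ K * (2 * (b - a)) by ring.
  apply: ler_pM.
  - by rewrite mulr_ge0 ?sqr_ge0 ?exprn_ge0//; case/andP: r01.
  - by rewrite exprn_ge0// invr_ge0.
  - by rewrite ler_wpM2l ?sqr_ge0//; case/andP: r01 => ? ?; rewrite ler_wiXn2l// ltW.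
  - by move: lj; rewrite exprS; lra.
have -> : RS_sum f f n p xi - (f T ^+ 2 - f 0 ^+ 2) / 2 =
   \sum_(i < n) (f (xi i) * (f (p i.+1) - f (p i))
    - (f (p i.+1) ^+ 2 - f (p i) ^+ 2) / 2).
  rewrite big_split/= sumrN; congr (_ - _).
  by rewrite -mulr_suml (telescope_ord (fun i => f (p i) ^+ 2)) pn p0.
apply: le_lt_trans (ler_norm_sum _ _ _) _.
apply: (@le_lt_trans _ _ (\sum_(i < n) 2 * C ^+ 2 * r ^+ K * (p i.+1 - p i))).
  by apply: ler_sum => i _; exact: piece.
rewrite -mulr_sumr telescope_ord pn p0 subr0.
have rK : r ^+ K <= eps / (4 * (C ^+ 2 + 1) * T) by apply: hN; exact: leq_maxr.
have C2 := sqr_ge0 C.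
have cT : 0 < 4 * (C ^+ 2 + 1) * T by rewrite !mulr_gt0// ltr_wpDl.
move: rK; rewrite ler_pdivlMr// => rK.
have rK0 : 0 <= r ^+ K by rewrite exprn_ge0//; case/andP: r01.
have : 0 <= r ^+ K * T by rewrite mulr_ge0// ltW.
have : 0 <= C ^+ 2 * (r ^+ K * T) by rewrite !mulr_ge0// ltW.
have E1 : r ^+ K * (4 * (C ^+ 2 + 1) * T) = 4 * (C ^+ 2 * (r ^+ K * T)) + 4 * (r ^+ K * T).
  by ring.
have -> : 2 * C ^+ 2 * r ^+ K * T = 2 * (C ^+ 2 * (r ^+ K * T)) by ring.
by move: rK; rewrite E1; lra.
Qed.

Lemma dyadic_modulusD q f g : 0 <= q -> dyadic_modulus q f -> dyadic_modulus q g ->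
  dyadic_modulus q (f \+ g).
Proof.
move=> q0 hf hg T T0; have [C [m [C0 fC]]] := hf T T0; have [D [n [D0 gD]]] := hg T T0.
exists (C + D), (maxn m n); split; first exact: addr_ge0.
move=> k s t; rewrite geq_max => /andP[mk nk] s0 st tT tsk.
have := fC k s t mk s0 st tT tsk; have := gD k s t nk s0 st tT tsk => h1 h2.
rewrite /= opprD addrACA mulrDl; apply: le_trans (ler_normD _ _) _; exact: lerD.
Qed.

Lemma dyadic_modulusM q f g : 0 <= q ->
  {within `[0, +oo[, continuous f} -> {within `[0, +oo[, continuous g} ->
  dyadic_modulus q f -> dyadic_modulus q g -> dyadic_modulus q (fun t => f t * g t).
Proof.
move=> q0 cf cg hf hg T T0; have [C [m [C0 fC]]] := hf T T0.
have [D [n [D0 gD]]] := hg T T0.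
have [A A0 fA] := bounded_segment cf T0; have [B B0 gB] := bounded_segment cg T0.
exists (C * B + A * D), (maxn m n); split; first by rewrite addr_ge0 ?mulr_ge0.
move=> k s t; rewrite geq_max => /andP[mk nk] s0 st tT tsk.
have := fC k s t mk s0 st tT tsk; have := gD k s t nk s0 st tT tsk => h1 h2.
have -> : f t * g t - f s * g s = (f t - f s) * g t + f s * (g t - g s) by ring.
have -> : (C * B + A * D) * q ^+ k = (C * q ^+ k) * B + A * (D * q ^+ k) by ring.
apply: le_trans (ler_normD _ _) _; rewrite !normrM lerD// ler_pM//.
  by apply: gB; rewrite tT (le_trans s0).
by apply: fA; rewrite s0 (le_trans st).
Qed.

(** On bounded intervals [G] is Lipschitz, and [2^-k <= q^k]. *)
Lemma dyadic_modulus_antiderivative q g G : 2^-1 <= q ->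
  {within `[0, +oo[, continuous g} -> antiderivative G g -> dyadic_modulus q G.
Proof.
move=> q2 cg GG T T0; have [B B0 gB] := bounded_segment cg T0.
exists B, 0%N; split=> // k s t _ s0 st tT tsk.
have [c /andP[sc ct] ->] := antiderivative_MVT GG s0 st.
rewrite normrM [X in _ * X]ger0_norm ?subr_ge0// ler_pM ?subr_ge0//.
  by apply: gB; rewrite (le_trans s0 sc) (le_trans ct tT).
by apply: le_trans tsk _; rewrite lerXn2r ?nnegrE ?invr_ge0//; lra.
Qed.

Lemma dyadic_modulus_cst q (c : R) : 0 <= q -> dyadic_modulus q (fun=> c).
Proof.
move=> q0 T T0; exists 0, 0%N; split=> // k s t _ _ _ _ _.
by rewrite subrr normr0 mul0r.
Qed.

(** On each dyadic cell the mean value theorem turns the increment of [G] into a value of [g], which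
    the modulus compares with the value at the left endpoint; the total error is at most
    [C T q^n]. *)
Lemma antiderivative_dyadic_sum q g G (T : nat) : 0 <= q < 1 ->
  dyadic_modulus q g -> antiderivative G g ->
  (\sum_(i < T * 2 ^ n) g (i%:R * 2^-1 ^+ n) * 2^-1 ^+ n) @[n --> \oo] --> G T%:R - G 0.
Proof.
move=> /andP[q0 q1] /(_ _ (ler0n R T))[C [m [C0 gC]]] GG.
apply/cvgrPdist_le => e e0.
have e1 : 0 < e / ((C + 1) * (T%:R + 1)).
  by rewrite divr_gt0// mulr_gt0// ltr_wpDl.
have q01 : 0 <= q < 1 by rewrite q0.
have [N hN] := exprn_small q01 e1.
exists (maxn m N) => // n /=; rewrite geq_max => /andP[mn Nn].
have h0 : (0 : R) < 2^-1 ^+ n by rewrite exprn_gt0// invr_gt0.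
have hn : (2 ^ n)%:R * (2^-1 : R) ^+ n = 1.
  by rewrite natrX -exprMn mulfV ?pnatr_eq0// expr1n.
pose p i : R := i%:R * 2^-1 ^+ n.
have pS i : p i.+1 - p i = 2^-1 ^+ n by rewrite /p -mulrBl mulrS addrK mul1r.
have -> : G T%:R - G 0 = \sum_(i < T * 2 ^ n) (G (p i.+1) - G (p i)).
  rewrite (telescope_ord (fun i => G (p i))) /p mul0r; congr (G _ - _).
  by rewrite natrM -mulrA hn mulr1.
rewrite -sumrB; apply: le_trans (ler_norm_sum _ _ _) _.
have piece (i : 'I_(T * 2 ^ n)) :
    `|G (p i.+1) - G (p i) - g (i%:R * 2^-1 ^+ n) * 2^-1 ^+ n| <= C * q ^+ n * 2^-1 ^+ n.
  have pi0 : 0 <= p i by rewrite mulr_ge0// ltW.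
  have pii : p i <= p i.+1 by rewrite -subr_ge0 pS ltW.
  have [c /andP[ic ci] ->] := antiderivative_MVT GG pi0 pii.
  rewrite pS -mulrBl normrM [X in _ * X]ger0_norm ?(ltW h0)// ler_pM2r//.
  apply: gC => //; last by have := pS i; rewrite -/(p i); lra.
  apply: le_trans ci _; rewrite /p.
  have : i.+1%:R <= (T * 2 ^ n)%:R :> R by rewrite ler_nat.
  by rewrite -(ler_pM2r h0) natrM -mulrA hn mulr1.
apply: (@le_trans _ _ (\sum_(i < T * 2 ^ n) C * q ^+ n * 2^-1 ^+ n)).
  by apply: ler_sum => i _; exact: piece.
rewrite sumr_const card_ord -[_ *+ (_ * _)]mulr_natr natrM.
rewrite (_ : _ * _ * _ * _ = C * T%:R * q ^+ n * ((2 ^ n)%:R * 2^-1 ^+ n)); last by ring.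
rewrite hn mulr1; have := hN n Nn.
have T0 : 0 <= T%:R :> R by [].
have CT : 0 < (C + 1) * (T%:R + 1) by rewrite mulr_gt0// ltr_wpDl.
rewrite ler_pdivlMr//; apply: le_trans; rewrite [leRHS]mulrC ler_wpM2r ?exprn_ge0//.
by rewrite mulrDl !mulrDr !mulr1 !mul1r; lra.
Qed.

End dyadic_modulus.

(** * Chaining *)

Section dyadic_chaining.
Context {R : realType}.
Implicit Types (f X Y : R -> R) (q C T : R).

(** The horizon [L * m] grows with the level [m], so that a single condition controls both the local
    modulus and the growth at infinity. *)
Definition dyadic_increments (L m0 : nat) q f := forall m i, (m0 <= m)%N ->
  (i < L * m * 2 ^ m)%N ->
  `|f (i.+1%:R * 2^-1 ^+ m) - f (i%:R * 2^-1 ^+ m)| <= q ^+ m.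

Variables (L m0 : nat) (q : R) (f : R -> R).
Hypotheses (L_gt0 : (0 < L)%N) (q0 : 0 <= q) (q1 : q < 1).
Hypotheses (cf : {within `[0, +oo[, continuous f}) (df : dyadic_increments L m0 q f).

Let fl (t : R) k := Num.truncn (t * 2 ^+ k).
Let dy (t : R) k : R := (fl t k)%:R * 2^-1 ^+ k.

Let half_gt0 k : (0 : R) < 2^-1 ^+ k.
Proof. by rewrite exprn_gt0// invr_gt0. Qed.

Let half_pow k : (2 : R) ^+ k * 2^-1 ^+ k = 1.
Proof. by rewrite -exprMn mulfV ?pnatr_eq0// expr1n. Qed.

Let fl_itv t k : 0 <= t -> (fl t k)%:R <= t * 2 ^+ k < (fl t k).+1%:R.
Proof. by move=> t0; apply: truncn_itv; rewrite mulr_ge0 ?exprn_ge0. Qed.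

Let dy_itv t k : 0 <= t -> 0 <= t - dy t k < 2^-1 ^+ k.
Proof.
move=> t0; have /andP[h1 h2] := fl_itv k t0.
have -> : t - dy t k = (t * 2 ^+ k - (fl t k)%:R) * 2^-1 ^+ k.
  by rewrite mulrBl -mulrA half_pow mulr1.
rewrite mulr_ge0 ?subr_ge0 ?(ltW (half_gt0 _))//= -[ltRHS]mul1r ltr_pM2r//.
by rewrite ltrBlDr addrC natr1.
Qed.

Let fl_lt t k m : 0 <= t -> t <= (L * m)%:R -> (m <= k)%N -> (fl t k <= L * k * 2 ^ k)%N.
Proof.
move=> t0 tL mk; rewrite -(ler_nat R); have /andP[h1 _] := fl_itv k t0.
apply: (le_trans h1); rewrite natrM natrX ler_wpM2r ?exprn_ge0//.
by apply: (le_trans tL); rewrite ler_nat leq_mul2l mk orbT.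
Qed.

(** Passing to the next level keeps the dyadic approximation [dy t k] of [t] or moves it by one step
    of level [k + 1], whose increment is controlled. *)
Let flS t k : 0 <= t -> fl t k.+1 = (fl t k).*2 \/ fl t k.+1 = (fl t k).*2.+1.
Proof.
move=> t0; have /andP[h1 h2] := fl_itv k t0; have /andP[h3 h4] := fl_itv k.+1 t0.
have h5 : ((fl t k).*2 <= fl t k.+1)%N.
  rewrite -ltnS -(ltr_nat R); apply: le_lt_trans h4.
  by rewrite -muln2 natrM exprSr mulrA ler_pM2r.
have h6 : (fl t k.+1 < (fl t k).*2.+2)%N.
  rewrite -(ltr_nat R) -doubleS; apply: (le_lt_trans h3).
  by rewrite -muln2 natrM exprSr mulrA ltr_pM2r.
move: h5 h6; rewrite leq_eqVlt => /orP[/eqP ->|]; first by left.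
by move=> h5; rewrite ltnS => h6; right; apply/eqP; rewrite eqn_leq h6.
Qed.

Let B := (1 - q)^-1.

Let B_gt0 : 0 < B. Proof. by rewrite invr_gt0 subr_gt0. Qed.

Let step t k m : 0 <= t -> t <= (L * m)%:R -> (m0 <= m)%N -> (m <= k)%N ->
  `|f (dy t k.+1) - f (dy t k)| <= q ^+ k.+1.
Proof.
move=> t0 tL m0m mk; have E : dy t k = (fl t k).*2%:R * 2^-1 ^+ k.+1.
  by rewrite /dy exprS -muln2 natrM -mulrA mulVKf ?pnatr_eq0.
have [h|h] := flS k t0; rewrite E /dy h.
  by rewrite subrr normr0 exprn_ge0.
apply: df; first by rewrite (leq_trans m0m)// (leq_trans mk).
by rewrite -h; apply: (fl_lt t0 tL); exact: leqW.
Qed.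

(** The bound is the exact geometric sum [q^k + ... + q^(k+n-1)], which lets the induction on [n]
    close. *)
Let chain t k m n : 0 <= t -> t <= (L * m)%:R -> (m0 <= m)%N -> (m <= k)%N ->
  `|f (dy t (k + n)) - f (dy t k)| <= (q ^+ k - q ^+ (k + n)) * B.
Proof.
move=> t0 tL m0m mk; elim: n => [|n IH]; first by rewrite addn0 !subrr normr0 mul0r.
have -> : f (dy t (k + n.+1)) - f (dy t k) =
    (f (dy t (k + n).+1) - f (dy t (k + n))) + (f (dy t (k + n)) - f (dy t k)).
  by rewrite addrA subrK addnS.
apply: (le_trans (ler_normD _ _)).
have -> : (q ^+ k - q ^+ (k + n.+1)) * B = q ^+ (k + n) + (q ^+ k - q ^+ (k + n)) * B.
  have BE : (1 - q) * B = 1 by rewrite mulfV// subr_eq0 eq_sym lt_eqF.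
  transitivity (q ^+ (k + n) * ((1 - q) * B) + (q ^+ k - q ^+ (k + n)) * B).
    by rewrite addnS exprS; ring.
  by rewrite BE mulr1.
apply: lerD => //; apply: le_trans (step t0 tL m0m _) _; first by rewrite (leq_trans mk) ?leq_addr.
by apply: ler_wiXn2l => //; exact: ltW.
Qed.

(** The bound of [chain] is uniform in [n]; continuity of [f] at [t] allows the passage to the
    limit. *)
Let near_dy t k m : 0 <= t -> t <= (L * m)%:R -> (m0 <= m)%N -> (m <= k)%N ->
  `|f t - f (dy t k)| <= B * q ^+ k.
Proof.
move=> t0 tL m0m mk; apply/ler_addgt0Pr => e e0.
have [d d0 hd] := within_continuous_dist cf t0 e0.
have h2 : 0 <= (2^-1 : R) < 1 by lra.
have d20 : 0 < d / 2 by lra.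
have [N hN] := exprn_small h2 d20.
have /andP[h3 h4] := dy_itv (k + N) t0.
have : `|f (dy t (k + N)) - f t| <= e.
  apply: hd; first by rewrite mulr_ge0// ltW.
  rewrite distrC ger0_norm//; apply: (lt_le_trans h4); apply: (@le_trans _ _ (d / 2)).
    by apply: hN; exact: leq_addl.
  by lra.
have : `|f (dy t (k + N)) - f (dy t k)| <= B * q ^+ k.
  apply: (le_trans (chain N t0 tL m0m mk)); rewrite mulrC ler_wpM2l ?(ltW B_gt0)//.
  by rewrite gerBl exprn_ge0.
set a := f t; set b := f (dy t (k + N)); set c := f (dy t k).
move=> h5 h6; have -> : a - c = (b - c) - (b - a) by ring.
by apply: (le_trans (ler_normB _ _)); exact: lerD.
Qed.

(** Both points are compared with their approximations of level [k], at cost [B q^k] each; as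
    [t - s <= 2^-k], these approximations coincide or are consecutive, at cost at most [q^k]. *)
Lemma dyadic_increments_modulus : dyadic_modulus q f.
Proof.
move=> T T0; pose m := (m0 + (Num.truncn T).+1)%N.
have TL : T <= (L * m)%:R.
  have /andP[_ /ltW h] := truncn_itv T0; apply: (le_trans h).
  rewrite ler_nat (leq_trans _ (leq_pmull _ L_gt0))//; exact: leq_addl.
have m0m : (m0 <= m)%N by exact: leq_addr.
exists (2 * B + 1), m; split; first by have := B_gt0; lra.
move=> k s t mk s0 st tT tsk; have t0 := le_trans s0 st.
have tL := le_trans tT TL; have sL := le_trans st tL.
have h1 := near_dy t0 tL m0m mk; have h2 := near_dy s0 sL m0m mk.
have h3 : `|f (dy t k) - f (dy s k)| <= q ^+ k.
  have /andP[a1 a2] := fl_itv k t0; have /andP[b1 b2] := fl_itv k s0.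
  have c1 : t * 2 ^+ k - s * 2 ^+ k <= 1.
    rewrite -mulrBl mulrC; apply: (@le_trans _ _ (2 ^+ k * 2^-1 ^+ k)).
      by rewrite ler_pM2l ?exprn_gt0.
    by rewrite half_pow.
  have c2 : s * 2 ^+ k <= t * 2 ^+ k by rewrite ler_pM2r ?exprn_gt0.
  have d1 : (fl s k <= fl t k)%N.
    by rewrite -ltnS -(ltr_nat R); lra.
  have d2 : (fl t k < (fl s k).+2)%N.
    by rewrite -(ltr_nat R) -[(fl s k).+2%:R]natr1; lra.
  move: d1; rewrite leq_eqVlt => /orP[/eqP E|d1].
    by rewrite /dy E subrr normr0 exprn_ge0.
  have E : fl t k = (fl s k).+1 by apply/eqP; rewrite eqn_leq d1 -ltnS d2.
  rewrite /dy E; apply: df; first exact: leq_trans mk.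
  by rewrite -E; exact: (fl_lt t0 tL).
have -> : f t - f s = (f t - f (dy t k)) + (f (dy t k) - f (dy s k)) - (f s - f (dy s k)) by ring.
have := ler_normB (f t - f (dy t k) + (f (dy t k) - f (dy s k))) (f s - f (dy s k)).
have := ler_normD (f t - f (dy t k)) (f (dy t k) - f (dy s k)).
by rewrite [X in _ -> _ -> _ <= X]mulrDl mul1r -mulrA; lra.
Qed.

(** With [j] the integer part of [t / L], the level [m = m0 + j + 1] has a horizon beyond [t]. Going
    from [0] to [dy t m] takes at most [L m 2^m <= L 4^m] increments, each at most [1], and
    [4^j <= exp (c L j) <= exp (c t)]. *)
Lemma dyadic_increments_growth (c : R) : 4 <= expR (c * L%:R) ->
  exists K, forall t, 0 <= t -> `|f t| <= K * expR (c * t).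
Proof.
move=> h4; have c0 : 0 <= c.
  rewrite leNgt; apply/negP => c0.
  have : expR (c * L%:R) <= 1 by rewrite -expR0 ler_expR mulr_le0_ge0// ltW.
  by lra.
exists (`|f 0| + B + L%:R * 4 ^+ m0.+1) => t t0.
pose j := Num.truncn (t / L%:R); pose m := (m0 + j.+1)%N.
have L0 : (0 : R) < L%:R by rewrite ltr0n.
have /andP[j1 j2] : j%:R <= t / L%:R < j.+1%:R by rewrite truncn_itv// divr_ge0// ltW.
have tL : t <= (L * m)%:R.
  rewrite natrM mulrC -ler_pdivrMr//; apply: (le_trans (ltW j2)).
  by rewrite ler_nat leq_addl.
have m0m : (m0 <= m)%N by exact: leq_addr.
have E1 : 1 <= expR (c * t) by rewrite -expR0 ler_expR mulr_ge0.
have h1 := near_dy t0 tL m0m (leqnn m).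
have hB : `|f t - f (dy t m)| <= B.
  by apply: (le_trans h1); rewrite ger_pMr// exprn_ile1// ltW.
have h2 : forall i, (i <= L * m * 2 ^ m)%N -> `|f (i%:R * 2^-1 ^+ m) - f 0| <= i%:R.
  elim=> [|i IH] h; first by rewrite mul0r subrr normr0.
  have -> : f (i.+1%:R * 2^-1 ^+ m) - f 0 = (f (i.+1%:R * 2^-1 ^+ m) - f (i%:R * 2^-1 ^+ m)) +
     (f (i%:R * 2^-1 ^+ m) - f 0) by ring.
  rewrite [leRHS]mulrS; apply: (le_trans (ler_normD _ _)); apply: lerD; last exact/IH/ltnW.
  by apply: (le_trans (df m0m h)); rewrite exprn_ile1// ltW.
have h3 : `|f (dy t m) - f 0| <= L%:R * 4 ^+ m0.+1 * expR (c * t).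
  apply: (le_trans (h2 _ (fl_lt t0 tL (leqnn m)))).
  apply: (@le_trans _ _ (L * m * 2 ^ m)%:R); first by rewrite ler_nat; exact: (fl_lt t0 tL).
  rewrite !natrM -!mulrA ler_pM2l//.
  apply: (@le_trans _ _ (4 ^+ m)).
    rewrite -natrM -natrX ler_nat -[4%N]/(2 * 2)%N expnMn leq_mul2r.
    by rewrite ltnW ?orbT// ltn_expl.
  rewrite /m addnS -addSn exprD ler_pM2l ?exprn_gt0//.
  apply: (@le_trans _ _ (expR (c * L%:R) ^+ j)); first by rewrite lerXn2r ?nnegrE ?expR_ge0.
  rewrite -expRM_natr ler_expR -mulrA ler_wpM2l// mulrC.
  by rewrite -ler_pdivlMr.
have -> : f t = (f t - f (dy t m)) + (f (dy t m) - f 0) + f 0 by ring.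
apply: (le_trans (ler_normD _ _)).
apply: (le_trans (lerD (ler_normD _ _) (lexx _))).
have : B <= B * expR (c * t) by rewrite ler_peMr// ltW.
have : `|f 0| <= `|f 0| * expR (c * t) by rewrite ler_peMr.
rewrite [X in _ -> _ -> _ <= X]mulrDl [X in _ -> _ -> _ <= X + _]mulrDl.
by lra.
Qed.

End dyadic_chaining.

(** * Pathwise analysis of the Langevin equation *)

Section langevin_path.
Context {R : realType}.
Variables (theta x0 q K : R) (X Y : R -> R).
Hypotheses (theta0 : 0 < theta) (q2 : 2^-1 <= q) (q1 : 2 * q ^+ 2 < 1).
Hypotheses (cX : {within `[0, +oo[, continuous X}) (cY : {within `[0, +oo[, continuous Y}).
Hypotheses (mY : dyadic_modulus q Y)
  (Y_le : forall t : R, 0 <= t -> `|Y t| <= K * expR (theta / 2 * t)).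

Let J (t : R) := Rintegral lebesgue_measure `[0, t] X.

Hypothesis X_eq : forall t : R, 0 <= t -> X t = x0 + theta * J t + Y t.

Let V (t : R) := expR (- theta * t) * J t.
Let g (t : R) := expR (- theta * t) * (x0 + Y t).

Let q0 : 0 <= q. Proof. by apply: le_trans q2; rewrite invr_ge0. Qed.

Let q_lt1 : q < 1.
Proof.
rewrite ltNge; apply/negP => h; have : 1 <= q ^+ 2 by rewrite exprn_ege1.
by move: q1; lra.
Qed.

(** By the equation, [X - theta J = x0 + Y], so [J] disappears from the derivative. *)
Let VV : antiderivative V g.
Proof.
have [cV dV] := antiderivativeM (antiderivative_expR (- theta)) (FTC_antiderivative cX).
split=> // t t0; apply: (@is_derive_eq _ _ _ _ _ _ _ _ (dV t t0)).
by rewrite /g X_eq ?ltW// /J; ring.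
Qed.

Let cx0Y : {within `[0, +oo[, continuous (fun t => x0 + Y t)}.
Proof. by move=> x; apply: cvgD; [exact: cvg_cst|exact: cY]. Qed.

Let cexp (c : R) : {within `[0, +oo[, continuous (fun t : R => expR (c * t))}.
Proof. exact/continuous_subspaceT/continuous_expRM. Qed.

Let mg : dyadic_modulus q g.
Proof.
apply: dyadic_modulusM => //.
  apply: (dyadic_modulus_antiderivative q2 _ (antiderivative_expR (- theta))).
  by move=> x; apply: cvgM; [exact: cvg_cst|exact: cexp].
by apply: dyadic_modulusD => //; exact: dyadic_modulus_cst.
Qed.

(** Presents the pathwise quantity as a limit of affine combinations of values of [Y], whose laws
    are known. *)
Lemma langevin_dyadic_sum (T : nat) :
  (\sum_(i < T * 2 ^ n) expR (- theta * (i%:R * 2^-1 ^+ n)) * (x0 + Y (i%:R * 2^-1 ^+ n))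
     * 2^-1 ^+ n) @[n --> \oo] -->
  expR (- theta * T%:R) * Rintegral lebesgue_measure `[0, T%:R] X.
Proof.
have q01 : 0 <= q < 1 by rewrite q0 q_lt1.
have := antiderivative_dyadic_sum (T := T) q01 mg VV.
by rewrite /V /J Rintegral_segment0 mulr0 subr0.
Qed.

(** Growth of [Y] at rate [theta / 2], half the discount rate, leaves [g] bounded by a multiple of
    [exp (- theta t / 2)]. *)
Lemma langevin_is_cvg : exists l : R,
  expR (- theta * t) * Rintegral lebesgue_measure `[0, t] X @[t --> +oo] --> l.
Proof.
have h2 : 0 < theta / 2 by rewrite divr_gt0.
have Kge0 : 0 <= K.
  by have := Y_le (lexx 0); rewrite mulr0 expR0 mulr1; exact: le_trans.
apply: (@antiderivative_is_cvg _ V g (theta / 2) (`|x0| + K) VV h2) => t t0.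
rewrite /g normrM ger0_norm ?expR_ge0//.
have -> : - theta * t = - (theta / 2) * t + - (theta / 2) * t by field.
rewrite expRD -mulrA mulrC ler_wpM2r ?expR_ge0//.
apply: (@le_trans _ _ (expR (- (theta / 2) * t) * ((`|x0| + K) * expR (theta / 2 * t)))).
  rewrite ler_wpM2l ?expR_ge0// (le_trans (ler_normD _ _))// mulrDl lerD ?Y_le//.
  by rewrite ler_peMr// -[leLHS]expR0 ler_expR mulr_ge0// ltW.
by rewrite mulrCA -expRD mulNr addNr expR0 mulr1.
Qed.

Let eq_cvgy (f h : R -> R) (l : R) : (forall t, 0 < t -> f t = h t) ->
  f t @[t --> +oo] --> l -> h t @[t --> +oo] --> l.
Proof.
move=> fh; apply: cvg_trans; apply: near_eq_cvg.
by exists 0; split=> // t t0 /=; rewrite fh.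
Qed.

(** After scaling by [exp (- 2 theta T)], the numerator tends to [(theta l)^2 / 2] and the
    denominator to [(theta l)^2 / (2 theta)], which is nonzero as [l] is. *)
Lemma langevin_estimator (l : R) : l != 0 ->
  expR (- theta * t) * Rintegral lebesgue_measure `[0, t] X @[t --> +oo] --> l ->
  exists I : R -> R, (forall T, 0 < T -> is_RS_integral X X 0 T (I T)) /\
    (fun T => I T / Rintegral lebesgue_measure `[0, T] (fun s => X s ^+ 2)) @ +oo --> theta.
Proof.
move=> l0 Vl; exists (fun T => (X T ^+ 2 - X 0 ^+ 2) / 2).
have mX : dyadic_modulus q X.
  (* The modulus is proved for the right-hand side of the equation, known to agree with [X] on the
     half-line, then transferred. *)
  have mJ : dyadic_modulus q (fun t => x0 + theta * J t + Y t).
    apply: dyadic_modulusD => //; apply: dyadic_modulusD => //; first exact: dyadic_modulus_cst.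
    apply: (dyadic_modulus_antiderivative q2 _ (antiderivativeZ _ (FTC_antiderivative cX))).
    by move=> x; apply: cvgM; [exact: cvg_cst|exact: cX].
  move=> T T0; have [C [m [C0 h]]] := mJ T T0; exists C, m; split=> // k s t mk s0 st tT tsk.
  by rewrite !X_eq ?(le_trans s0 st)//; exact: h.
split=> [T T0|]; first exact: (is_RS_integral_self q0 q1 T0 mX).
have h2 : 0 < theta / 2 by rewrite divr_gt0.
have h2t : 0 < 2 * theta by rewrite mulr_gt0.
have eY : expR (- theta * t) * Y t @[t --> +oo] --> 0.
  apply: (@squeeze_cvgr _ _ _ _ (fun t => - (K * expR (- (theta / 2) * t)))
     (fun t => K * expR (- (theta / 2) * t))).
  - exists 0; split=> // t t0; rewrite -ler_norml normrM ger0_norm ?expR_ge0//.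
    apply: (le_trans (ler_wpM2l _ (Y_le (ltW t0)))); first exact: expR_ge0.
    by rewrite mulrCA -expRD le_eqVlt; apply/orP; left; apply/eqP; congr (_ * expR _); field.
  - by rewrite -oppr0 -(mulr0 K); apply: cvgN; apply: cvgM; [exact: cvg_cst|exact: expRN_cvg0].
  - by rewrite -(mulr0 K); apply: cvgM; [exact: cvg_cst|exact: expRN_cvg0].
have eX : expR (- theta * t) * X t @[t --> +oo] --> theta * l.
  have : expR (- theta * t) * x0 + theta * V t + expR (- theta * t) * Y t @[t --> +oo]
     --> 0 * x0 + theta * l + 0.
    apply: cvgD eY; apply: cvgD; last by apply: cvgM Vl; exact: cvg_cst.
    by apply: cvgM; [exact: expRN_cvg0|exact: cvg_cst].
  rewrite mul0r add0r addr0; apply: eq_cvgy => t t0.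
  by rewrite X_eq ?ltW// /V; ring.
have eX2 : expR (- (2 * theta) * t) * X t ^+ 2 @[t --> +oo] --> (theta * l) ^+ 2.
  apply: eq_cvgy (cvgM eX eX) => t t0.
  have -> : - (2 * theta) * t = - theta * t + - theta * t by ring.
  by rewrite ?fctE expRD; ring.
have cX2 : {within `[0, +oo[, continuous (fun t => X t ^+ 2)}.
  by move=> x; apply: cvgM; exact: cX.
have eF := antiderivative_cvg_expR (FTC_antiderivative cX2) h2t eX2.
have eI : expR (- (2 * theta) * t) * ((X t ^+ 2 - X 0 ^+ 2) / 2) @[t --> +oo]
    --> (theta * l) ^+ 2 / 2.
  have : (expR (- (2 * theta) * t) * X t ^+ 2 - expR (- (2 * theta) * t) * X 0 ^+ 2) / 2
     @[t --> +oo] --> ((theta * l) ^+ 2 - 0 * X 0 ^+ 2) / 2.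
    apply: cvgM; last exact: cvg_cst.
    by apply: cvgB => //; apply: cvgM; [exact: expRN_cvg0|exact: cvg_cst].
  rewrite mul0r subr0; apply: eq_cvgy => t t0.
  by rewrite -mulrBr mulrA.
have F0 : (theta * l) ^+ 2 / (2 * theta) != 0.
  by rewrite !mulf_neq0 ?invr_eq0// ?gt_eqF// expf_neq0// mulf_neq0// gt_eqF.
have := cvgM eI (cvgV F0 eF).
have -> : (theta * l) ^+ 2 / 2 * ((theta * l) ^+ 2 / (2 * theta))^-1 = theta.
  by field; rewrite l0 gt_eqF.
move=> h; refine (@eq_cvgy _ _ _ _ (h _ _)) => t t0; rewrite /unstable.inv_fun /= invfM [_ * (_ / 2)]mulrC -!mulrA; congr (_ * (_ * _)).
by rewrite mulrA mulfV ?mul1r// gt_eqF// expR_gt0.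
Qed.

End langevin_path.

(** * The harmonizable kernel *)

Section dyadic_integrability.
Context {R : realType}.
Notation mu := (@lebesgue_measure R).

Lemma nneseries_geometric_lty (C r : R) : 0 <= C -> 0 <= r < 1 ->
  (\sum_(0 <= k <oo) (C * r ^+ k)%:E < +oo)%E.
Proof.
move=> C0 /andP[r0 r1]; apply: (@le_lt_trans _ _ (C / (1 - r))%:E); last exact: ltry.
apply: lime_le.
  by apply: is_cvg_nneseries => n _ _; rewrite lee_fin mulr_ge0 ?exprn_ge0.
apply: nearW => n; rewrite sumEFin lee_fin -mulr_sumr ler_wpM2l//.
have r10 : 0 < 1 - r by lra.
have E : (1 - r) * (\sum_(0 <= k < n) r ^+ k) = 1 - r ^+ n.
  elim: n => [|n IH]; first by rewrite big_geq// mulr0 subrr.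
  by rewrite big_nat_recr//= mulrDr IH exprS; ring.
by rewrite -[leRHS]mul1r ler_pdivlMr// mulrC E gerBl exprn_ge0.
Qed.

Lemma lebesgue_measure_ball0 (a : R) : 0 <= a -> mu `[- a, a] = (2 * a)%:E.
Proof.
move=> a0; rewrite lebesgue_measure_itv/= lte_fin; case: ltP => [_|h].
  by rewrite -EFinB; congr EFin; ring.
by congr EFin; lra.
Qed.

(* Compares [F] with a series of indicators of the intervals [[- 2^-k, 2^-k]] and
   [[- 2^(k+1), 2^(k+1)]]. *)
Lemma dyadic_integrable (F : R -> R) (C r : R) : measurable_fun setT F ->
  0 <= C -> 0 <= r < 1 -> (forall u, 0 <= F u) -> F 0 <= C ->
  (forall k u, 2^-1 ^+ k.+1 <= `|u| <= 2^-1 ^+ k -> F u <= C * (2 * r) ^+ k) ->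
  (forall k u, 2 ^+ k <= `|u| <= 2 ^+ k.+1 -> F u <= C * (2^-1 * r) ^+ k) ->
  mu.-integrable setT (EFin \o F).
Proof.
move=> mF C0 r01 F0 FC Fsmall Fbig; have r0 : 0 <= r by case/andP: r01.
pose A k : set R := `[- (2^-1 ^+ k), 2^-1 ^+ k]%classic.
pose B k : set R := `[- (2 ^+ k.+1), 2 ^+ k.+1]%classic.
pose gA k u := ((C * (2 * r) ^+ k)%:E * (\1_(A k) u)%:E)%E.
pose gB k u := ((C * (2^-1 * r) ^+ k)%:E * (\1_(B k) u)%:E)%E.
pose g k u := (gA k u + gB k u)%E.
have h2k k : (0:R) < 2^-1 ^+ k by rewrite exprn_gt0// invr_gt0.
have cA k : 0 <= C * (2 * r) ^+ k by rewrite mulr_ge0// exprn_ge0// mulr_ge0.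
have cB k : 0 <= C * (2^-1 * r) ^+ k by rewrite mulr_ge0// exprn_ge0// mulr_ge0// invr_ge0.
have gA0 k u : (0 <= gA k u)%E by rewrite /gA -EFinM lee_fin mulr_ge0.
have gB0 k u : (0 <= gB k u)%E by rewrite /gB -EFinM lee_fin mulr_ge0.
have g0 k u : (0 <= g k u)%E by rewrite adde_ge0.
have mgA k : measurable_fun setT (gA k).
  apply: measurable_funeM; apply/measurable_EFinP; apply: measurable_indic.
  exact: measurable_itv.
have mgB k : measurable_fun setT (gB k).
  apply: measurable_funeM; apply/measurable_EFinP; apply: measurable_indic.
  exact: measurable_itv.
have mg k : measurable_fun setT (g k) by exact: emeasurable_funD.
apply/integrableP; split; first exact/measurable_EFinP.
have Fg u : (`|(EFin \o F) u| <= \sum_(0 <= k <oo) g k u)%E.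
  have single k c : F u <= c -> (c%:E <= g k u)%E ->
      (`|(EFin \o F) u| <= \sum_(0 <= k <oo) g k u)%E.
    move=> Fc cg; rewrite /= ger0_norm//; apply: (@le_trans _ _ (g k u)).
      by apply: le_trans cg; rewrite lee_fin.
    have := @nneseries_lim_ge R (g ^~ u) xpredT 0 k.+1 (fun n _ _ => g0 n u).
    by apply: le_trans; rewrite big_nat_recr//= leeDr// sume_ge0.
  have gAle k : `|u| <= 2^-1 ^+ k -> ((C * (2 * r) ^+ k)%:E <= g k u)%E.
    move=> uk; rewrite /g /gA indicE mem_set ?mule1 ?leeDl//.
    by rewrite /A /= in_itv/= -ler_norml.
  have gBle k : `|u| <= 2 ^+ k.+1 -> ((C * (2^-1 * r) ^+ k)%:E <= g k u)%E.
    move=> uk; rewrite /g /gB indicE mem_set ?mule1 ?leeDr//.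
    by rewrite /B /= in_itv/= -ler_norml.
  (* The point [0] lies in no dyadic shell; the bound on [F 0] covers it at level [0]. *)
  have [u0|u0] := eqVneq u 0.
    apply: (single 0%N C); first by rewrite u0.
    have := gAle 0%N; rewrite !expr0 mulr1; apply.
    by rewrite u0 normr0.
  have nu0 : 0 < `|u| by rewrite normr_gt0.
  have [u1|u1] := leP `|u| 1.
    have [k _ uk] := @dyadic_scale _ `|u| 0 nu0 u1.
    by apply: (single k _ (Fsmall _ _ uk)); apply: gAle; case/andP: uk.
  have [k _ /andP[k1 k2]] := @dyadic_scale R `|u|^-1 0 (eq_ind_r is_true nu0 (invr_gt0 _))
     (ltW (eq_ind_r is_true u1 (invf_lt1 nu0))).
  have uk : 2 ^+ k <= `|u| <= 2 ^+ k.+1.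
    move: k1 k2; rewrite !exprVn lef_pV2 ?posrE ?exprn_gt0// => ->.
    by rewrite lef_pV2 ?posrE ?exprn_gt0// => ->.
  by apply: (single k _ (Fbig _ _ uk)); apply: gBle; case/andP: uk.
apply: (@le_lt_trans _ _ (\int[mu]_u (\sum_(0 <= k <oo) g k u))%E).
  apply: ge0_le_integral => //.
  - by apply: measurableT_comp => //; exact/measurable_EFinP.
  - by apply: ge0_emeasurable_sum => // k _; exact: mg.
rewrite integral_nneseries//.
(* [6 C] is [2 C + 4 C]: the intervals have lengths [2 * 2^-k] and [4 * 2^k], which cancel the
   powers of [2] in the two bounds. *)
have -> : (\sum_(0 <= k <oo) \int[mu]_u g k u = \sum_(0 <= k <oo) ((6 * C) * r ^+ k)%:E)%E.
  apply: eq_eseriesr => k _.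
  rewrite /g ge0_integralD//; [rewrite /gA /gB|exact: mgA|exact: mgB].
  have mA : measurable (A k) by exact: measurable_itv.
  have mB : measurable (B k) by exact: measurable_itv.
  have i1 (c : R) (S : set R) : 0 <= c -> measurable S ->
      (\int[mu]_u (c%:E * (\1_S u)%:E) = c%:E * mu S)%E.
    move=> c0 mS; rewrite ge0_integralZl_EFin//.
    - by rewrite integral_indic// setIT.
    - by apply/measurable_EFinP; apply: measurable_indic.
  rewrite !i1// !lebesgue_measure_ball0 ?exprn_ge0 ?invr_ge0//.
  rewrite -!EFinM -EFinD; congr EFin; rewrite !exprMn exprS exprVn.
  by field; rewrite expf_neq0.
by apply: nneseries_geometric_lty => //; rewrite mulr_ge0.
Qed.
End dyadic_integrability.

(** * Kernels of the process and their square-integrable envelope *)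

Section harmonizable_kernel.
Context {R : realType}.
Notation mu := (@lebesgue_measure R).
Implicit Types (t s u l : R).

Lemma expR_lipschitz (p q M : R) : expR p <= M -> expR q <= M ->
  `|expR p - expR q| <= `|p - q| * M.
Proof.
wlog qp : p q / q <= p.
  move=> hw pM qM; have [h|/ltW h] := leP q p; first exact: hw.
  by rewrite distrC [`|p - q|]distrC; exact: hw.
move=> pM _; rewrite !ger0_norm ?subr_ge0 ?ler_expR//.
have -> : expR p - expR q = expR p * (1 - expR (q - p)).
  by rewrite mulrBr mulr1 -expRD; congr (_ - expR _); ring.
rewrite mulrC ler_pM ?expR_ge0//.
  by rewrite subr_ge0 -expR0 ler_expR subr_le0.
by have := expR_ge1Dx (q - p); lra.
Qed.

Lemma lipschitz_of_derive (f df : R -> R) : (forall x : R, is_derive x 1 f (df x)) ->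
  (forall x, `|df x| <= 1) -> forall x y, `|f x - f y| <= `|x - y|.
Proof.
move=> fd d1 x y; wlog yx : x y / y <= x.
  move=> hw; have [h|/ltW h] := leP y x; first exact: hw.
  by rewrite distrC [leRHS]distrC; exact: hw.
have [|c _ ->] := @MVT_segment R f df y x yx (fun x _ => fd x).
  apply: derivable_within_continuous => z _; by have [] := fd z.
by rewrite normrM ler_piMl.
Qed.

Lemma cos_lipschitz (x y : R) : `|cos x - cos y| <= `|x - y|.
Proof.
apply: (@lipschitz_of_derive cos (fun x => - sin x)) => z.
by rewrite normrN; exact: sin_max.
Qed.

Lemma sin_lipschitz (x y : R) : `|sin x - sin y| <= `|x - y|.
Proof.
apply: (@lipschitz_of_derive sin cos) => z; exact: cos_max.
Qed.

Definition kernel_factor (h u : R) : R := `|u| `^ (- (h + 2^-1)).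

(* For [phi = cos] and [phi = sin], the real and imaginary parts of
   [(exp (i t u) - 1) / |u| ^ (H t + 1/2)]. *)
Definition mbm_kernel (phi : R -> R) (H : R -> R) t u : R :=
  (phi (t * u) - phi 0) * kernel_factor (H t) u.

(* Square-integrable envelope of the kernels and of their increments: near [0] the exponent
   leaves room for a logarithm, at infinity for a factor [|u| ^ a]. *)
Definition weight (h1 h2 a u : R) : R :=
  if `|u| <= 1 then `|u| `^ (- (h2 / 2)) else `|u| `^ (a - h1 - 2^-1).

Lemma weight_ge0 (h1 h2 a u : R) : 0 <= weight h1 h2 a u.
Proof. by rewrite /weight; case: ifP; rewrite powR_ge0. Qed.

Lemma measurable_weight (h1 h2 a : R) : measurable_fun setT (weight h1 h2 a).
Proof.
apply: measurable_fun_ifT.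
- apply: (measurable_fun_ler (f := @Num.norm R R) (g := fun=> 1)) => //; exact: normr_measurable.
- by apply: (measurableT_comp (measurable_powR _)); exact: normr_measurable.
- by apply: (measurableT_comp (measurable_powR _)); exact: normr_measurable.
Qed.

Lemma powR_norm_expR (u p : R) : u != 0 -> `|u| `^ p = expR (p * ln `|u|).
Proof. by move=> u0; rewrite /powR normr_eq0 (negbTE u0). Qed.

Lemma weight_small (h1 h2 a u : R) : u != 0 -> `|u| <= 1 ->
  weight h1 h2 a u = expR (- (h2 / 2) * ln `|u|).
Proof. by move=> u0 u1; rewrite /weight u1 powR_norm_expR. Qed.

Lemma weight_large (h1 h2 a u : R) : 1 < `|u| ->
  weight h1 h2 a u = expR ((a - h1 - 2^-1) * ln `|u|).
Proof.
move=> u1; rewrite /weight leNgt u1/= powR_norm_expR// -normr_gt0.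
exact: lt_trans u1.
Qed.

(** The square is [|u|^(-h2)] near [0] and [|u|^(2 (a - h1) - 1)] at infinity. Its integral over
    successive dyadic shells is dominated by geometric series of ratios [r1 = 2^h2 / 2 < 1] and
    [r2 = 2^(2 (a - h1)) < 1]. *)
Lemma weight_integrable (h1 h2 a : R) : 0 < h2 < 1 -> a < h1 ->
  mu.-integrable setT (EFin \o (fun u => weight h1 h2 a u ^+ 2)).
Proof.
move=> /andP[h20 h21] ah; have l2 : 0 < ln (2 : R) by rewrite ln_gt0// ltr1n.
pose r1 := expR (h2 * ln 2) / 2; pose r2 : R := expR (2 * (a - h1) * ln 2).
have E2 : expR (ln 2) = 2 :> R by rewrite lnK ?posrE.
have r11 : r1 < 1.
  by rewrite ltr_pdivrMr// mul1r -[ltRHS]E2 ltr_expR -[ltRHS]mul1r ltr_pM2r.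
have r21 : r2 < 1.
  by rewrite -[ltRHS]expR0 ltr_expR pmulr_llt0// pmulr_rlt0// subr_lt0.
have r10 : 0 <= r1 by rewrite divr_ge0 ?expR_ge0.
(* The constant [2] absorbs the factor [2^h2 <= 2] arising near [0], where [|u|] is only known to be
   at least [2^-(k+1)]. *)
apply: (@dyadic_integrable _ _ 2 (Num.max r1 r2)) => //.
- by apply: measurable_funX; exact: measurable_weight.
- by rewrite le_max r10 gt_max r11.
- by move=> u; rewrite sqr_ge0.
- rewrite /weight normr0 ler01 /powR eqxx; case: eqP => _; rewrite ?expr1n ?expr0n/=; lra.
- move=> k u /andP[uk1 uk2].
  have u0 : 0 < `|u| by apply: lt_le_trans uk1; rewrite exprn_gt0 ?invr_gt0.
  have u1 : `|u| <= 1 by apply: (le_trans uk2); apply: exprn_ile1; lra.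
  rewrite weight_small//; last by rewrite -normr_gt0.
  have lk : - (k.+1%:R * ln 2) <= ln `|u|.
    have -> : - (k.+1%:R * ln 2) = ln ((2^-1 : R) ^+ k.+1).
      by rewrite exprVn lnV ?posrE ?exprn_gt0// lnXn// mulr_natl.
    by rewrite ler_ln ?posrE ?exprn_gt0 ?invr_gt0.
  apply: (@le_trans _ _ (2 * (2 * r1) ^+ k)); last first.
    rewrite ler_pM2l// lerXn2r ?nnegrE ?mulr_ge0// ?le_max ?r10//.
    by rewrite ler_pM2l// le_max lexx.
  have -> : 2 * r1 = expR (h2 * ln 2) by rewrite /r1; field.
  rewrite -!expRM_natr.
  have -> : 2 * expR (h2 * ln 2 * k%:R) = expR (ln 2 + h2 * ln 2 * k%:R) by rewrite expRD E2.
  rewrite ler_expR.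
  have : h2 * (- (k.+1%:R * ln 2)) <= h2 * ln `|u| by rewrite ler_pM2l.
  have : h2 * ln 2 <= 1 * ln 2 by rewrite ler_pM2r// ltW.
  by rewrite -[k.+1%:R]natr1; lra.
- move=> k u /andP[uk1 uk2].
  have : 1 <= `|u| by apply: le_trans uk1; rewrite exprn_ege1// ler1n.
  (* At [|u| = 1] the weight follows its branch near [0], and only [k = 0] is possible. *)
  rewrite le_eqVlt => /predU1P[u1|u1].
    have k0 : k = 0%N.
      case: k uk1 {uk2} => // k; rewrite -u1 exprS => h.
      have h' : 1 <= (2:R) ^+ k by rewrite exprn_ege1// ler1n.
      by exfalso; move: h h'; set z := 2 ^+ k; lra.
    by rewrite k0 expr0 mulr1 /weight -u1 lexx powR1 expr1n; lra.
  rewrite weight_large//.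
  have lk : k%:R * ln 2 <= ln `|u|.
    have -> : k%:R * ln 2 = ln ((2 : R) ^+ k) by rewrite lnXn// mulr_natl.
    by rewrite ler_ln ?posrE ?exprn_gt0//; exact: lt_trans u1.
  apply: (@le_trans _ _ ((2^-1 * r2) ^+ k)); last first.
    apply: (@le_trans _ _ ((2^-1 * Num.max r1 r2) ^+ k)).
      rewrite lerXn2r ?nnegrE ?mulr_ge0 ?expR_ge0 ?invr_ge0// ?le_max ?r10//.
      by rewrite ler_pM2l ?invr_gt0// le_max lexx orbT.
    rewrite ler_peMl//; last lra.
    by rewrite exprn_ge0// mulr_ge0 ?invr_ge0// le_max r10.
  have -> : 2^-1 * r2 = expR ((2 * (a - h1) - 1) * ln 2).
    by rewrite mulrBl mul1r expRD expRN E2 mulrC.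
  rewrite -!expRM_natr ler_expR.
  have c0 : 0 <= 1 - 2 * (a - h1) by lra.
  have := ler_wpM2l c0 lk; lra.
Qed.

End harmonizable_kernel.

(** * Pointwise bounds on the kernels and on their increments in time *)

Section kernel_bounds.
Context {R : realType}.
Variables (h1 h2 a D kappa : R) (H : R -> R).
Hypotheses (h21 : h2 < 1).
Hypotheses (a2 : 2^-1 < a) (ak : a <= kappa) (a1 : a <= 1) (D0 : 0 < D).
Hypothesis Hh : forall t, 0 <= t -> h1 <= H t <= h2.

Variable phi : R -> R.
Hypotheses (phi_lip : forall x y, `|phi x - phi y| <= `|x - y|) (phi1 : forall x, `|phi x| <= 1).

Let w := weight h1 h2 a.

Lemma powR_anti (x p r : R) : 0 < x <= 1 -> p <= r -> x `^ r <= x `^ p.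
Proof.
move=> /andP[x0 x1] pr; rewrite /powR gt_eqF// ler_expR.
have := ln_le0 x1; have := ler_wnM2r; move=> hw l0; exact: hw.
Qed.

Lemma kernel0 t : mbm_kernel phi H t 0 = 0.
Proof. by rewrite /mbm_kernel mulr0 subrr mul0r. Qed.

Lemma kernel_factorE h (u : R) : u != 0 -> kernel_factor h u = expR (- (h + 2^-1) * ln `|u|).
Proof. by move=> u0; rewrite /kernel_factor powR_norm_expR. Qed.

Let phi2 x y : `|phi x - phi y| <= 2.
Proof. by apply: (le_trans (ler_normB _ _)); have := phi1 x; have := phi1 y; lra. Qed.

(** Near [0] the Lipschitz bound [t |u|] raises the exponent to [1/2 - H t], which is at least
    [- h2 / 2] because [h2 < 1]; at infinity the numerator is at most [2]. *)
Lemma kernel_le (t u : R) : 0 <= t -> `|mbm_kernel phi H t u| <= (2 + t) * w u.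
Proof.
move=> t0; have [->|u0] := eqVneq u 0.
  by rewrite kernel0 normr0 mulr_ge0 ?weight_ge0// addr_ge0.
have uE : `|u| = expR (ln `|u|) by rewrite lnK ?posrE ?normr_gt0.
have /andP[H1 H2] := Hh t0; rewrite /mbm_kernel normrM kernel_factorE// [X in _ * X]ger0_norm ?expR_ge0//.
have [u1|u1] := leP `|u| 1.
  have l0 := ln_le0 u1; rewrite /w weight_small//.
  apply: (@le_trans _ _ (t * expR (- (h2 / 2) * ln `|u|))); last first.
    by rewrite ler_pM2r ?expR_gt0// lerDr.
  apply: (@le_trans _ _ (t * expR (ln `|u|) * expR (- (H t + 2^-1) * ln `|u|))).
    rewrite ler_pM2r ?expR_gt0// -uE; apply: (le_trans (phi_lip _ _)).
    by rewrite subr0 normrM (ger0_norm t0).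
  rewrite -mulrA -expRD ler_wpM2l// ler_expR -subr_le0.
  have c0 : 0 <= 2^-1 - H t + h2 / 2 by move: h21 H2; lra.
  have -> : ln `|u| + - (H t + 2^-1) * ln `|u| - - (h2 / 2) * ln `|u|
    = (2^-1 - H t + h2 / 2) * ln `|u| by field.
  exact: mulr_ge0_le0.
have l0 := ln_ge0 (ltW u1); rewrite /w weight_large//.
apply: ler_pM; rewrite ?expR_ge0//.
  by apply: (le_trans (phi2 _ _)); lra.
by rewrite ler_expR ler_wpM2r//; move: a2 H1; lra.
Qed.

(** The increment splits into a change of phase at fixed exponent and a change of exponent at fixed
    phase. The latter produces the factor [|ln |u||], absorbed by the slack in the weight on each
    side of [|u| = 1]. *)
Lemma kernel_increment_le (s t u : R) : 0 <= s -> s <= t -> t - s <= 1 ->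
  `|H t - H s| <= D * (t - s) `^ kappa ->
  `|mbm_kernel phi H t u - mbm_kernel phi H s u| <=
    (2 + 4 * D + 2 * D / (1 - h2)) * (1 + s) * (t - s) `^ a * w u.
Proof.
move=> s0; rewrite le_eqVlt => /predU1P[<-|st] d1 HD.
  have h20 : 0 < 1 - h2 by rewrite subr_gt0.
  rewrite subrr normr0 !mulr_ge0 ?weight_ge0 ?powR_ge0 ?addr_ge0//.
  - by rewrite mulr_ge0// ltW.
  - by rewrite divr_ge0 ?mulr_ge0// ltW.
have t0 : 0 <= t by rewrite (le_trans s0)// ltW.
set d := t - s in d1 HD *; set p := d `^ a; set K := 2 + 4 * D + 2 * D / (1 - h2).
have d0 : 0 < d by rewrite subr_gt0.
have p0 : 0 < p by rewrite powR_gt0.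
have d01 : 0 < d <= 1 by rewrite d0.
have dp : d <= p by rewrite -[leLHS](powRr1 (ltW d0)) powR_anti.
have dk : `|H t - H s| <= D * p.
  by apply: (le_trans HD); rewrite ler_wpM2l ?(ltW D0)// powR_anti.
have D2 : 0 <= 2 * D / (1 - h2) by rewrite divr_ge0 ?mulr_ge0 ?subr_ge0 ?(ltW D0)// ltW.
have [->|u0] := eqVneq u 0.
  rewrite !kernel0 subrr normr0 mulr_ge0 ?weight_ge0// mulr_ge0 ?(ltW p0)// mulr_ge0 ?addr_ge0//.
  by rewrite mulr_ge0// ltW.
have u_gt0 : 0 < `|u| by rewrite normr_gt0.
have uE : `|u| = expR (ln `|u|) by rewrite lnK ?posrE.
have /andP[Ht1 Ht2] := Hh t0; have /andP[Hs1 Hs2] := Hh s0.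
have -> : mbm_kernel phi H t u - mbm_kernel phi H s u =
    (phi (t * u) - phi (s * u)) * kernel_factor (H t) u +
    (phi (s * u) - phi 0) * (kernel_factor (H t) u - kernel_factor (H s) u).
  by rewrite /mbm_kernel; ring.
apply: (le_trans (ler_normD _ _)); rewrite !normrM !kernel_factorE//.
rewrite [X in _ * X + _]ger0_norm ?expR_ge0//.
set l := ln `|u| in uE *.
have N1 : `|phi (t * u) - phi (s * u)| <= d * expR l.
  by rewrite -uE; apply: (le_trans (phi_lip _ _)); rewrite -mulrBl normrM gtr0_norm.
have N2 : `|phi (s * u) - phi 0| <= s * expR l.
  by rewrite -uE; apply: (le_trans (phi_lip _ _)); rewrite subr0 normrM ger0_norm.
have dH : `|- (H t + 2^-1) * l - - (H s + 2^-1) * l| <= D * p * `|l|.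
  have -> : - (H t + 2^-1) * l - - (H s + 2^-1) * l = - ((H t - H s) * l) by ring.
  by rewrite normrN normrM ler_wpM2r.
have [u1|u1] := leP `|u| 1.
  have l0 : l <= 0 := ln_le0 u1; rewrite /w weight_small// -/l.
  set m := expR (- (h2 + 2^-1) * l); set W := expR (- (h2 / 2) * l).
  have em x : x <= h2 -> expR (- (x + 2^-1) * l) <= m.
    by move=> xh; rewrite ler_expR ler_wnM2r//; lra.
  have T1 : expR l * m <= W.
    rewrite -expRD ler_expR -subr_le0.
    have -> : l + - (h2 + 2^-1) * l - - (h2 / 2) * l = (2^-1 - h2 / 2) * l by field.
    by rewrite mulr_ge0_le0//; move: h21; lra.
  have eta0 : 0 < 1 - h2 by rewrite subr_gt0.
  (* The logarithm is paid for by [|u|^(- (1 - h2) / 2)], which brings the exponent exactly to that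
     of the weight, [- h2 / 2]. *)
  have labs : `|l| <= 2 / (1 - h2) * expR (- ((1 - h2) / 2) * l).
    rewrite ler0_norm// mulrAC ler_pdivlMr//.
    have := expR_ge1Dx (- ((1 - h2) / 2) * l); lra.
  have T2 : expR l * (expR (- ((1 - h2) / 2) * l) * m) = W.
    by rewrite -!expRD; congr expR; field.
  have F1 : `|phi (t * u) - phi (s * u)| * expR (- (H t + 2^-1) * l) <= p * W.
    apply: (@le_trans _ _ (d * expR l * m)).
      by apply: ler_pM; rewrite ?expR_ge0// em.
    by rewrite -mulrA; apply: ler_pM; rewrite ?mulr_ge0 ?expR_ge0// ltW.
  have F2 : `|phi (s * u) - phi 0| * `|expR (- (H t + 2^-1) * l) - expR (- (H s + 2^-1) * l)|
     <= 2 * D / (1 - h2) * s * p * W.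
    have EE := expR_lipschitz (em _ Ht2) (em _ Hs2).
    apply: (@le_trans _ _ ((s * expR l) * ((D * p * (2 / (1 - h2) * expR (- ((1 - h2) / 2) * l))) * m))).
      apply: ler_pM => //; apply: (le_trans EE); rewrite ler_wpM2r ?expR_ge0//.
      by apply: (le_trans dH); rewrite ler_wpM2l// mulr_ge0// ltW.
    by rewrite -T2 le_eqVlt; apply/orP; left; apply/eqP; field; rewrite gt_eqF.
  apply: (le_trans (lerD F1 F2)).
  have -> : p * W + 2 * D / (1 - h2) * s * p * W = (1 + 2 * D / (1 - h2) * s) * (p * W) by ring.
  rewrite -[leRHS]mulrA ler_wpM2r ?mulr_ge0 ?expR_ge0 ?(ltW p0)//.
  have : 0 <= D * s by rewrite mulr_ge0// ltW.
  by rewrite /K; set D3 := 2 * D / (1 - h2) in D2 *; move: D0; nra.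
have l0 : 0 <= l := ln_ge0 (ltW u1); rewrite /w weight_large// -/l.
set m := expR (- (h1 + 2^-1) * l); set W := expR ((a - h1 - 2^-1) * l).
have em x : h1 <= x -> expR (- (x + 2^-1) * l) <= m.
  by move=> xh; rewrite ler_expR ler_wpM2r//; lra.
have WE : expR (a * l) * m = W by rewrite -expRD; congr expR; ring.
(* Interpolation between the bounds [d |u|] and [2]: the smaller of the two is at most
   [2 (d |u|)^a], as [0 <= a <= 1]. *)
have N3 : `|phi (t * u) - phi (s * u)| <= 2 * (p * expR (a * l)).
  have -> : p * expR (a * l) = (d * `|u|) `^ a.
    by rewrite powRM ?(ltW d0)// powR_norm_expR.
  have z0 : 0 < d * `|u| by rewrite mulr_gt0.
  have [z1|z1] := leP (d * `|u|) 1.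
    have zz : d * `|u| <= (d * `|u|) `^ a.
      by rewrite -[leLHS](powRr1 (ltW z0)) powR_anti// z0.
    by move: N1 zz z0; rewrite -uE; set q := _ `^ a; lra.
  have zz : 1 <= (d * `|u|) `^ a.
    rewrite -[leLHS](powRr0 (d * `|u|)) ler_powR// ?(ltW z1)//.
    by apply: le_trans (ltW a2); rewrite invr_ge0.
  by apply: (le_trans (phi2 _ _)); lra.
have labs : `|l| <= 2 * expR (a * l).
  rewrite ger0_norm//; have h := expR_ge1Dx (a * l).
  have : 2^-1 * l <= a * l by rewrite ler_wpM2r// ltW.
  by lra.
have F1 : `|phi (t * u) - phi (s * u)| * expR (- (H t + 2^-1) * l) <= 2 * p * W.
  apply: (@le_trans _ _ (2 * (p * expR (a * l)) * m)).
    by apply: ler_pM; rewrite ?expR_ge0// em.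
  by rewrite -WE !mulrA.
have F2 : `|phi (s * u) - phi 0| * `|expR (- (H t + 2^-1) * l) - expR (- (H s + 2^-1) * l)|
     <= 4 * D * p * W.
  have EE := expR_lipschitz (em _ Ht1) (em _ Hs1).
  apply: (@le_trans _ _ (2 * ((D * p * (2 * expR (a * l))) * m))).
    apply: ler_pM => //; apply: (le_trans EE); rewrite ler_wpM2r ?expR_ge0//.
    by apply: (le_trans dH); rewrite ler_wpM2l// mulr_ge0// ltW.
  by rewrite -WE le_eqVlt; apply/orP; left; apply/eqP; ring.
apply: (le_trans (lerD F1 F2)).
have -> : 2 * p * W + 4 * D * p * W = (2 + 4 * D) * (p * W) by ring.
rewrite -[leRHS]mulrA ler_wpM2r ?mulr_ge0 ?expR_ge0 ?(ltW p0)//.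
have : 0 <= D * s by rewrite mulr_ge0// ltW.
have : 0 <= 2 * D / (1 - h2) * s by rewrite mulr_ge0.
by rewrite /K; set D3 := 2 * D / (1 - h2) in D2 *; move: D0; nra.
Qed.

End kernel_bounds.

(** * Variance of multifractional Brownian motion *)

Section increments.
Context {R : realType}.

Lemma sqr_le_of_norm (x y : R) : `|x| <= y -> x ^+ 2 <= y ^+ 2.
Proof.
move=> xy; rewrite -real_normK ?num_real// lerXn2r ?nnegrE//.
exact: le_trans xy.
Qed.

(** Casts an increment as a two-term linear combination, the form used in the definition of a
    Gaussian process. *)
Lemma increment_sum (t s : R) (f : R -> R) :
  \sum_(i < 2) (if i == ord0 then 1 else -1) * f (if i == ord0 then t else s) = f t - f s.
Proof. by rewrite !big_ord_recl big_ord0/=; ring. Qed.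

Lemma increment_quadratic_form (C : R -> R -> R) (t s : R) : C t s = C s t ->
  \sum_(i < 2) \sum_(j < 2) (if i == ord0 then 1 else -1) * (if j == ord0 then 1 else -1) *
    C (if i == ord0 then t else s) (if j == ord0 then t else s) = C t t - 2 * C t s + C s s.
Proof. by move=> CE; rewrite !big_ord_recl !big_ord0/= -CE; ring. Qed.

Lemma powR_exprn (x a : R) (m : nat) : 0 <= x -> (x ^+ m) `^ a = (x `^ a) ^+ m.
Proof.
move=> x0; elim: m => [|m IH]; first by rewrite !expr0 powR1.
by rewrite !exprS powRM ?exprn_ge0// IH.
Qed.

End increments.

Section mbm_variance.
Context {R : realType}.
Notation mu := (@lebesgue_measure R).
Variables (h1 h2 a D kappa : R) (H : R -> R).
Hypotheses (ah1 : a < h1) (h21 : h2 < 1) (h2_gt0 : 0 < h2).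
Hypotheses (a2 : 2^-1 < a) (ak : a <= kappa) (a1 : a <= 1) (D0 : 0 < D).
Hypothesis Hh : forall t : R, 0 <= t -> h1 <= H t <= h2.
Hypothesis HD : forall t s : R, 0 <= s -> s <= t -> `|H t - H s| <= D * (t - s) `^ kappa.

Let w := weight h1 h2 a.

Let iw : mu.-integrable setT (EFin \o (fun u => w u ^+ 2)).
Proof. by apply: weight_integrable => //; rewrite h2_gt0. Qed.

Lemma measurable_kernel (phi : R -> R) (t : R) : continuous phi ->
  measurable_fun setT (mbm_kernel phi H t).
Proof.
move=> cphi; apply: measurable_funM.
  apply: measurable_funB => //; apply: continuous_measurable_fun => u.
  by apply: continuous_comp; [apply: cvgM; [exact: cvg_cst|exact: cvg_id]|exact: cphi].
by apply: (measurableT_comp (measurable_powR _)); exact: normr_measurable.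
Qed.

Lemma integrable_le_weight (F : R -> R) (C : R) : measurable_fun setT F ->
  (forall u, `|F u| <= C * w u ^+ 2) -> mu.-integrable setT (EFin \o F).
Proof.
move=> mF FC; apply: (@le_integrable _ _ _ mu setT _ _ (EFin \o (fun u => C * w u ^+ 2))) => //.
- exact/measurable_EFinP.
- by move=> u _ /=; rewrite lee_fin (le_trans (FC u))// ler_norm.
- exact: (integrableZl measurableT C iw).
Qed.

Lemma Rintegral_sum (I : Type) (s : seq I) (F : I -> R -> R) :
  (forall i, mu.-integrable setT (EFin \o F i)) ->
  mu.-integrable setT (EFin \o (fun u => \sum_(i <- s) F i u)) /\
  Rintegral mu setT (fun u => \sum_(i <- s) F i u) = \sum_(i <- s) Rintegral mu setT (F i).
Proof.
move=> iF; elim: s => [|i s [IH1 IH2]].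
  under eq_fun do rewrite big_nil; rewrite big_nil; split; first exact: integrable0.
  by rewrite Rintegral_cst// mul0r.
have -> : (fun u => \sum_(j <- i :: s) F j u) = (fun u => F i u + \sum_(j <- s) F j u).
  by apply/funext => u; rewrite big_cons.
rewrite big_cons; split; last by rewrite RintegralD// IH2.
exact: (integrableD measurableT (iF i) IH1).
Qed.

Let A (t u : R) := mbm_kernel cos H t u.
Let B (t u : R) := mbm_kernel sin H t u.

Let mA t : measurable_fun setT (A t).
Proof. apply: measurable_kernel; exact: continuous_cos. Qed.

Let mB t : measurable_fun setT (B t).
Proof. apply: measurable_kernel; exact: continuous_sin. Qed.

Let A_le t u : 0 <= t -> `|A t u| <= (2 + t) * w u.
Proof. apply: (kernel_le h21 a2 Hh); [exact: cos_lipschitz|exact: cos_max]. Qed.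

Let B_le t u : 0 <= t -> `|B t u| <= (2 + t) * w u.
Proof. apply: (kernel_le h21 a2 Hh); [exact: sin_lipschitz|exact: sin_max]. Qed.

Let iAB t s : 0 <= t -> 0 <= s -> mu.-integrable setT (EFin \o (fun u => A t u * A s u + B t u * B s u)).
Proof.
move=> t0 s0; apply: (@integrable_le_weight _ (2 * ((2 + t) * (2 + s)))).
  by apply: measurable_funD; apply: measurable_funM; exact: mA || exact: mB.
move=> u; apply: (le_trans (ler_normD _ _)).
rewrite [`|A t u * _|]normrM [`|B t u * _|]normrM.
have p1 := ler_pM (normr_ge0 _) (normr_ge0 _) (A_le u t0) (A_le u s0).
have p2 := ler_pM (normr_ge0 _) (normr_ge0 _) (B_le u t0) (B_le u s0).
apply: (le_trans (lerD p1 p2)); rewrite le_eqVlt; apply/orP; left; apply/eqP; ring.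
Qed.

Lemma mbm_covE t s : 0 <= t -> 0 <= s -> mbm_cov H t s =
  (2 * pi)^-1 * Rintegral mu setT (fun u => A t u * A s u + B t u * B s u).
Proof.
move=> t0 s0; congr (_ * _); apply: eq_Rintegral => u _.
have -> : - (H t + H s + 1) = - (H t + 2^-1) + - (H s + 2^-1) by field.
have /andP[Ht _] := Hh t0; have /andP[Hs _] := Hh s0.
(* At base [0] the addition rule for powers requires a nonzero total exponent; here it is negative
   since [H >= h1 > a > 1/2]. *)
rewrite powRD; last first.
  by apply/implyP => /eqP h; exfalso; move: ah1 a2 Ht Hs h; lra.
by rewrite /A /B /mbm_kernel /kernel_factor cos0 sin0; ring.
Qed.

Lemma mbm_covC t s : mbm_cov H t s = mbm_cov H s t.
Proof.
congr (_ * _); apply: eq_Rintegral => u _.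
by rewrite [H t + H s]addrC; congr (_ * _); ring.
Qed.

(** The covariance is an [L^2] inner product of kernels, so the quadratic form is the squared norm
    of their combination; the two squares carry its real and imaginary parts. *)
Lemma mbm_variance (n : nat) (t : 'I_n -> R) (c : 'I_n -> R) : (forall i, 0 <= t i) ->
  let Q u := (\sum_(i < n) c i * A (t i) u) ^+ 2 + (\sum_(i < n) c i * B (t i) u) ^+ 2 in
  mu.-integrable setT (EFin \o Q) /\
  \sum_(i < n) \sum_(j < n) c i * c j * mbm_cov H (t i) (t j) = (2 * pi)^-1 * Rintegral mu setT Q.
Proof.
move=> t0 Q; pose F (ij : 'I_n * 'I_n) u := c ij.1 * c ij.2 *
   (A (t ij.1) u * A (t ij.2) u + B (t ij.1) u * B (t ij.2) u).
have iF ij : mu.-integrable setT (EFin \o F ij).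
  exact: (integrableZl measurableT (c ij.1 * c ij.2) (iAB (t0 ij.1) (t0 ij.2))).
have QE : Q = (fun u => \sum_(ij : 'I_n * 'I_n) F ij u).
  apply/funext => u; rewrite /Q !expr2 !big_distrlr/= !pair_big/= -big_split/=.
  by apply: eq_bigr => -[i j] _; rewrite /F/=; ring.
have [h1' h2'] := Rintegral_sum (index_enum _) iF; rewrite QE; split=> //.
rewrite h2' mulr_sumr pair_big/=; apply: eq_bigr => -[i j] _ /=.
by rewrite mbm_covE// RintegralZl//; [ring|exact: iAB].
Qed.

Lemma mbm_increment_variance : exists2 K, 0 < K & forall s t, 0 <= s -> s <= t -> t - s <= 1 ->
  0 <= mbm_cov H t t - 2 * mbm_cov H t s + mbm_cov H s s <= (K * (1 + s) * (t - s) `^ a) ^+ 2.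
Proof.
pose K1 := 2 + 4 * D + 2 * D / (1 - h2); pose J := Rintegral mu setT (fun u => w u ^+ 2).
have J0 : 0 <= J by apply: Rintegral_ge0 => u _; exact: sqr_ge0.
have pi0 : 0 < (2 * pi)^-1 :> R by rewrite invr_gt0 mulr_gt0// pi_gt0.
pose V := (2 * pi)^-1 * (2 * K1 ^+ 2 * J).
have V0 : 0 <= V by rewrite mulr_ge0 ?(ltW pi0)// mulr_ge0// mulr_ge0 ?sqr_ge0.
(* Adding [1] makes the constant positive without evaluating [J]. *)
exists (Num.sqrt (V + 1)) => [|s t s0 st ts1]; first by rewrite sqrtr_gt0 ltr_wpDl.
have t0 := le_trans s0 st.
have tt0 : forall i : 'I_2, 0 <= if i == ord0 then t else s by move=> i; case: ifP.
have [iQ E] := mbm_variance (fun i : 'I_2 => if i == ord0 then 1 else -1) tt0.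
have QE : (fun u =>
    (\sum_(i < 2) (if i == ord0 then 1 else -1) * A (if i == ord0 then t else s) u) ^+ 2 +
    (\sum_(i < 2) (if i == ord0 then 1 else -1) * B (if i == ord0 then t else s) u) ^+ 2) =
    (fun u => (A t u - A s u) ^+ 2 + (B t u - B s u) ^+ 2).
  by apply/funext => u; rewrite !(increment_sum t s (_^~ u)).
rewrite {}QE in iQ E; rewrite (increment_quadratic_form (mbm_covC t s)) in E.
rewrite {}E; apply/andP; split.
  apply: mulr_ge0; first exact: ltW.
  by apply: Rintegral_ge0 => u _; apply: addr_ge0; exact: sqr_ge0.
set p := (t - s) `^ a; pose M := (K1 * (1 + s) * p) ^+ 2.
have MV : (2 * pi)^-1 * (2 * M * J) <= (Num.sqrt (V + 1) * (1 + s) * p) ^+ 2.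
  have -> : (2 * pi)^-1 * (2 * M * J) = V * ((1 + s) ^+ 2 * p ^+ 2) by rewrite /V /M; ring.
  rewrite !exprMn sqr_sqrtr ?addr_ge0// -[leRHS]mulrA.
  by apply: ler_wpM2r; [apply: mulr_ge0; exact: sqr_ge0|rewrite lerDl].
apply: le_trans MV; apply: ler_wpM2l; first exact: ltW.
rewrite /J -RintegralZl//; apply: le_Rintegral => //.
  exact: (integrableZl measurableT (2 * M) iw).
move=> u _.
have kA : `|A t u - A s u| <= K1 * (1 + s) * p * w u :=
  kernel_increment_le h21 a2 ak a1 D0 Hh (@cos_lipschitz R) (@cos_max R) u s0 st ts1 (HD s0 st).
have kB : `|B t u - B s u| <= K1 * (1 + s) * p * w u :=
  kernel_increment_le h21 a2 ak a1 D0 Hh (@sin_lipschitz R) (@sin_max R) u s0 st ts1 (HD s0 st).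
have -> : 2 * M * w u ^+ 2 = (K1 * (1 + s) * p * w u) ^+ 2 + (K1 * (1 + s) * p * w u) ^+ 2.
  by rewrite -mulrA mulr_natl mulr2n [(K1 * _ * _ * _) ^+ 2]exprMn.
by apply: lerD; exact: sqr_le_of_norm.
Qed.

(* Only the real parts are used: there [cos (t u) - 1 <= 0], so nothing cancels; the integral
   is restricted to [1 <= u <= 2]. *)
Lemma mbm_variance_lower : exists2 k, 0 < k & forall n (t : 'I_n -> R) (c : 'I_n -> R),
  (forall i, 0 <= t i) -> (forall i, H (t i) <= 1) -> (forall i, 0 <= c i) ->
  k * (\sum_(i < n | 2^-1 <= t i <= 1) c i) ^+ 2 <=
  \sum_(i < n) \sum_(j < n) c i * c j * mbm_cov H (t i) (t j).
Proof.
have pi0 : 0 < (2 * pi)^-1 :> R by rewrite invr_gt0 mulr_gt0// pi_gt0.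
have pi2 : (2 : R) <= pi by exact: pi_ge2.
(* For [1/2 <= t <= 1] and [1 <= u <= 2], the product [t u] lies in [[1/2, 2]], inside [[0, pi]]
   where [cos] decreases; hence [1 - cos (t u) >= c1]. *)
pose c1 : R := 1 - cos 2^-1.
have c10 : 0 < c1.
  by rewrite subr_gt0 -[ltRHS]cos0 ltr_cos ?in_itv/=; lra.
exists ((2 * pi)^-1 * (c1 / 4) ^+ 2) => [|n t c t0 H1 c0].
  by rewrite mulr_gt0// exprn_gt0// divr_gt0.
have [iQ ->] := mbm_variance c t0; rewrite -mulrA ler_pM2l//.
set S := \sum_(i < n | _) c i.
have S0 : 0 <= S by apply: sumr_ge0 => i _.
have m12 : mu `[1, 2] = 1%:E.
  by rewrite lebesgue_measure_itv/= lte_fin ltr1n -EFinB; congr EFin; lra.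
set Q := (X in Rintegral mu setT X).
apply: (@le_trans _ _ (Rintegral mu `[1, 2] Q)); last first.
  rewrite Rintegral_mkcond; apply: le_Rintegral => //.
  - rewrite -restrict_EFin; apply/integrable_restrict => //.
    by apply: integrableS iQ => //; exact: measurableI.
  - move=> u _; rewrite patchE; case: ifP => _ //.
    by rewrite /Q addr_ge0// sqr_ge0.
have -> : (c1 / 4) ^+ 2 * S ^+ 2 = Rintegral mu `[1, 2] (fun=> (c1 / 4) ^+ 2 * S ^+ 2).
  by rewrite Rintegral_cst// (congr1 fine m12) /= mulr1.
apply: le_Rintegral => //.
- apply: continuous_compact_integrable; first exact: segment_compact.
  by apply: continuous_subspaceT => x; exact: cvg_cst.
- by apply: integrableS iQ => //; exact: classical_sets.subsetT.
move=> u; rewrite /= in_itv/= => /andP[u1 u2].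
have u0 : 0 < u by lra.
have un0 : u != 0 by rewrite gt_eqF.
rewrite /Q -exprMn; apply: (@le_trans _ _ ((\sum_(i < n) c i * A (t i) u) ^+ 2)); last first.
  by rewrite lerDl sqr_ge0.
rewrite -[leRHS]sqrrN lerXn2r ?nnegrE ?mulr_ge0 ?divr_ge0 ?(ltW c10)//.
  rewrite -sumrN sumr_ge0// => i _; rewrite /A /mbm_kernel -mulrN -mulNr.
  by rewrite mulr_ge0// mulr_ge0 ?powR_ge0// opprB cos0 subr_ge0 cos_le1.
rewrite -sumrN /S mulr_sumr [leRHS](bigID (fun i => 2^-1 <= t i <= 1))/= -[leLHS]addr0.
apply: lerD; last first.
  apply: sumr_ge0 => i _; rewrite /A /mbm_kernel -mulrN -mulNr.
  by rewrite mulr_ge0// mulr_ge0 ?powR_ge0// opprB cos0 subr_ge0 cos_le1.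
apply: ler_sum => i /andP[ti1 ti2]; rewrite mulrC -mulrN ler_wpM2l// /A /mbm_kernel -mulNr opprB cos0.
apply: ler_pM; rewrite ?(ltW c10) ?invr_ge0//.
  have tu1 : 2^-1 <= t i * u.
    by rewrite -[leLHS]mulr1; apply: ler_pM => //; rewrite invr_ge0.
  have tu2 : t i * u <= 2.
    by rewrite -[leRHS]mul1r; apply: ler_pM => //; exact: ltW.
  have c2 : 2^-1 <= pi :> R by apply: le_trans pi2; lra.
  have z2 : (0 : R) <= 2^-1 by rewrite invr_ge0.
  rewrite lerD2l lerN2 leNgt ltr_cos ?in_itv/= -?leNgt ?tu1 ?z2 ?c2//.
  by rewrite (le_trans z2 tu1) (le_trans tu2 pi2).
(* Origin of [1 / 4]: as [H + 1/2 <= 2] and [1 <= u <= 2], the kernel factor is at least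
   [u^-2 >= 1/4]. *)
rewrite kernel_factorE// ger0_norm ?(ltW u0)//.
have l0 : 0 <= ln u by apply: ln_ge0.
apply: (@le_trans _ _ (expR (- 2 * ln u))).
  have -> : - 2 * ln u = - (ln u + ln u) by ring.
  rewrite expRN expRD lnK ?posrE// lef_pV2 ?posrE ?mulr_gt0//.
  by have := ler_pM (ltW u0) (ltW u0) u2 u2; lra.
by rewrite ler_expR ler_wpM2r//; have := H1 i; lra.
Qed.

End mbm_variance.

(** * Almost sure properties *)

Section gaussian_estimates.
Context {R : realType}.
Notation mu := (@lebesgue_measure R).

(** The [k]-th power of [z / k <= exp (z / k)], inverted. *)
Lemma expRN_le_pow (k : nat) (z : R) : 0 < z -> expR (- z) <= (k%:R / z) ^+ k.
Proof.
case: k => [|k] z0; first by rewrite expr0 -expR0 ler_expR oppr_le0 ltW.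
have k0 : (0 : R) < k.+1%:R by rewrite ltr0n.
have zk : 0 < z / k.+1%:R by rewrite divr_gt0.
have -> : k.+1%:R / z = (z / k.+1%:R)^-1 by rewrite invf_div.
rewrite expRN exprVn lef_pV2 ?posrE ?expR_gt0 ?exprn_gt0//.
have {2}-> : z = (z / k.+1%:R) * k.+1%:R by rewrite divfK ?gt_eqF.
rewrite expRM_natr lerXn2r ?nnegrE ?expR_ge0 ?(ltW zk)//.
by apply: le_trans (expR_ge1Dx _); rewrite lerDr.
Qed.

Lemma normal_peak_sqrt (v : R) : 0 < v -> normal_peak (Num.sqrt v) = (Num.sqrt (v * pi *+ 2))^-1.
Proof. by move=> v0; rewrite /normal_peak sqr_sqrtr// ltW. Qed.

(* On [x ^ 2 > l ^ 2], the density of variance [v] is at most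
   [sqrt 2 * exp (- l ^ 2 / (4 v))] times the density of variance [2 v]. *)
Lemma centered_gaussian_tail (v l : R) : 0 <= v -> 0 < l ->
  (centered_gaussian_law v [set x : R | (l < `|x|)%R] <=
    if (v == 0)%R then 0 else (Num.sqrt 2 * expR (- (l ^+ 2 / (4 * v))))%:E)%E.
Proof.
move=> v0 l0; rewrite /centered_gaussian_law; case: eqP => [_|/eqP vn0].
  by rewrite diracE memNset//= normr0 => /(lt_trans l0); rewrite ltxx.
have {vn0} v0 : 0 < v by rewrite lt_neqAle eq_sym vn0.
have mA : measurable [set x : R | l < `|x|].
  have -> : [set x : R | (l < `|x|)%R] = setT `&` (@Num.norm R R) @^-1` `]l, +oo[%classic.
    by rewrite setTI; apply/seteqP; split => x; rewrite /= in_itv/= andbT.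
  by apply: normr_measurable => //; exact: measurable_itv.
have s0 : Num.sqrt v != 0 by rewrite gt_eqF// sqrtr_gt0.
have s20 : Num.sqrt (2 * v) != 0 by rewrite gt_eqF// sqrtr_gt0 mulr_gt0.
have c0 : 0 <= Num.sqrt 2 * expR (- (l ^+ 2 / (4 * v))) by rewrite mulr_ge0 ?expR_ge0.
set c := Num.sqrt 2 * _ in c0 *.
have mpdf (s : R) : measurable_fun [set: R] (EFin \o normal_pdf 0 s).
  by apply/measurable_EFinP; exact: measurable_normal_pdf.
rewrite /normal_prob; apply: (@le_trans _ _ (\int[mu]_(x in [set x : R | (l < `|x|)%R]) (c%:E * (normal_pdf 0 (Num.sqrt (2 * v)) x)%:E))%E).
  apply: ge0_le_integral => //.
  - by move=> x _; rewrite lee_fin normal_pdf_ge0.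
  - by apply: measurable_funTS; exact: mpdf.
  - by apply: measurable_funTS; apply: measurable_funeM; exact: mpdf.
  move=> x /= lx; rewrite -EFinM lee_fin !normal_pdfE//= !normal_peak_sqrt ?mulr_gt0//.
  rewrite /normal_fun !subr0 !sqr_sqrtr ?mulr_ge0 ?(ltW v0)//.
  have -> : 2 * v * pi *+ 2 = 2 * (v * pi *+ 2) by ring.
  rewrite sqrtrM// invfM /c.
  have q2 : Num.sqrt (2 : R) != 0 by rewrite gt_eqF// sqrtr_gt0.
  set pk := (Num.sqrt (v * pi *+ 2))^-1.
  have pk0 : 0 <= pk by rewrite invr_ge0.
  have -> : Num.sqrt 2 * expR (- (l ^+ 2 / (4 * v))) * ((Num.sqrt 2)^-1 * pk * expR (- x ^+ 2 / (2 * v *+ 2)))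
     = pk * (expR (- (l ^+ 2 / (4 * v))) * expR (- x ^+ 2 / (2 * v *+ 2))) by field.
  rewrite ler_wpM2l// -expRD ler_expR.
  have v40 : 0 < 4 * v by rewrite mulr_gt0.
  have -> : - (l ^+ 2 / (4 * v)) + - x ^+ 2 / (2 * v *+ 2) = - (l ^+ 2 + x ^+ 2) / (4 * v).
    by field; rewrite gt_eqF.
  have -> : - x ^+ 2 / (v *+ 2) = - (x ^+ 2 + x ^+ 2) / (4 * v).
    by field; rewrite gt_eqF.
  rewrite ler_pM2r ?invr_gt0// lerN2 lerD2r -[leRHS]real_normK ?num_real//.
  by rewrite lerXn2r ?nnegrE ?(ltW l0)// ltW.
apply: (@le_trans _ _ (\int[mu]_x (c%:E * (normal_pdf 0 (Num.sqrt (2 * v)) x)%:E))%E).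
  apply: ge0_subset_integral => //; first by apply: measurable_funeM; exact: mpdf.
  by move=> x _; rewrite -EFinM lee_fin mulr_ge0// normal_pdf_ge0.
rewrite ge0_integralZl_EFin//.
- by rewrite integral_normal_pdf mule1.
- by move=> x _; rewrite lee_fin normal_pdf_ge0.
- exact: mpdf.
Qed.

(** Trades the exponential tail for an arbitrary power of [s / l], so that rates geometric in the
    level give geometric probabilities. When [v = 0] the law is a Dirac mass and the tail
    vanishes. *)
Lemma centered_gaussian_tail_pow (k : nat) (v s l : R) : 0 <= v -> v <= s ^+ 2 -> 0 < s -> 0 < l ->
  (centered_gaussian_law v [set x : R | (l < `|x|)%R] <=
    (Num.sqrt 2 * (4 * k%:R * (s / l) ^+ 2) ^+ k)%:E)%E.
Proof.
move=> v0 vs s0 l0; apply: (le_trans (centered_gaussian_tail v0 l0)).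
case: eqP => [_|/eqP vn0].
  by rewrite lee_fin mulr_ge0// exprn_ge0// mulr_ge0 ?sqr_ge0// mulr_ge0.
have {vn0} v0 : 0 < v by rewrite lt_neqAle eq_sym vn0.
rewrite lee_fin ler_wpM2l//.
apply: (@le_trans _ _ (expR (- (l ^+ 2 / (4 * s ^+ 2))))).
  rewrite ler_expR lerN2 ler_wpM2l ?sqr_ge0// lef_pV2 ?posrE ?mulr_gt0 ?exprn_gt0//.
  by rewrite ler_pM2l.
apply: (le_trans (expRN_le_pow k _)).
  by rewrite divr_gt0 ?mulr_gt0 ?exprn_gt0.
rewrite le_eqVlt; apply/orP; left; apply/eqP; congr (_ ^+ k).
by field; rewrite !gt_eqF.
Qed.

(** The density is at most [1 / sqrt (2 pi v) <= 1 / sqrt k] on an interval of length [2 e]; the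
    bound is uniform in the variance and in the shift [c]. *)
Lemma centered_gaussian_small_ball (v k c e : R) : 0 < k -> k <= v -> 0 < e ->
  (centered_gaussian_law v [set x : R | (`|c + x| < e)%R] <= (2 * e / Num.sqrt k)%:E)%E.
Proof.
move=> k0 kv e0; have v0 := lt_le_trans k0 kv.
rewrite /centered_gaussian_law gt_eqF//.
have -> : [set x | `|c + x| < e] = `]- c - e, - c + e[%classic.
  apply/seteqP; split => x; rewrite /= in_itv/= ltr_norml => /andP[h1 h2]; apply/andP; split; lra.
have s0 : Num.sqrt v != 0 by rewrite gt_eqF// sqrtr_gt0.
set J := `]- c - e, - c + e[%classic.
have mJ : measurable J by exact: measurable_itv.
rewrite /normal_prob; apply: (@le_trans _ _ (\int[mu]_(x in J) (cst ((Num.sqrt k)^-1)%:E x))%E).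
  apply: ge0_le_integral => //.
  - by move=> x _; rewrite lee_fin normal_pdf_ge0.
  - by apply/measurable_EFinP/measurable_funTS; exact: measurable_normal_pdf.
  move=> x _ /=; rewrite lee_fin; apply: (le_trans (normal_pdf_ub 0 x s0)); rewrite normal_peak_sqrt//.
  rewrite lef_pV2 ?posrE ?sqrtr_gt0 ?mulrn_wgt0 ?mulr_gt0 ?pi_gt0// ler_sqrt ?mulrn_wge0 ?mulr_ge0 ?(ltW v0) ?pi_ge0//.
  rewrite -mulr_natr -mulrA; apply: (le_trans kv); rewrite ler_peMr ?(ltW v0)//.
  by have := pi_ge2 R; lra.
have muJ : mu J = (2 * e)%:E.
  rewrite /J lebesgue_measure_itv/= lte_fin ifT; last lra.
  by rewrite -EFinB; congr EFin; ring.
rewrite integral_cst// (_ : (_ * _)%E = ((Num.sqrt k)^-1)%:E * (2 * e)%:E)%E.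
  by rewrite -EFinM lee_fin mulrC.
by congr (_ * _)%E; exact: muJ.
Qed.

End gaussian_estimates.

Section probability_limits.
Context {R : realType} {d} {Omega : measurableType d} (P : probability Omega R).

(** The intersections over [n >= N] increase with [N], and each is contained in [A N]; continuity
    from below concludes. *)
Lemma probability_liminf_le (A : (set Omega)^nat) (c : \bar R) :
  (forall n, measurable (A n)) -> (forall n, (P (A n) <= c)%E) ->
  measurable (\bigcup_N \bigcap_(n >= N) A n) /\
  (P (\bigcup_N \bigcap_(n >= N) A n) <= c)%E.
Proof.
move=> mA Ac; pose B N := \bigcap_(n >= N) A n.
have mB N : measurable (B N) by apply: bigcap_measurable => //; exists N => /=.
have mU : measurable (\bigcup_N B N) by exact: bigcup_measurable.
split=> //; have := @nondecreasing_cvg_mu _ _ _ P B mB mU.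
have ndB : {homo B : n m / (n <= m)%N >-> (n <= m)%O}.
  by move=> n m nm; apply/subsetPset => w Bw i /= mi; apply: Bw => /=; exact: leq_trans mi.
move=> /(_ ndB) /cvg_lim <- //; apply: lime_le.
  apply/cvg_ex; exists (P (\bigcup_N B N)); exact: nondecreasing_cvg_mu.
apply: nearW => n /=; apply: le_trans (Ac n); apply: le_measure; rewrite ?inE//.
by move=> w; apply => /=.
Qed.

End probability_limits.

(** * Almost sure control of the dyadic increments *)

Section mbm_paths.
Context {R : realType} {d} {Omega : measurableType d} (P : probability Omega R).
Variables (H : R -> R) (Y : R -> Omega -> R).
Hypothesis YG : centered_gaussian_process P Y (mbm_cov H).

Lemma mbm_increment_law (s t : R) (A : set R) : 0 <= s -> 0 <= t -> measurable A ->
  P ((fun w => Y t w - Y s w) @^-1` A) =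
  centered_gaussian_law (mbm_cov H t t - 2 * mbm_cov H t s + mbm_cov H s s) A.
Proof.
move=> s0 t0 mA; have [_ law] := YG.
have tt0 : forall i : 'I_2, 0 <= if i == ord0 then t else s by move=> i; case: ifP.
have -> : (fun w => Y t w - Y s w) = (fun w => \sum_(i < 2)
    (if i == ord0 then 1 else -1) * Y (if i == ord0 then t else s) w).
  by apply/funext => w; rewrite (increment_sum t s (Y ^~ w)).
rewrite (law 2%N _ (fun i => if i == ord0 then 1 else -1) tt0 A mA).
by rewrite (increment_quadratic_form (mbm_covC H t s)).
Qed.

Let mY t : measurable_fun setT (Y t). Proof. by have [] := YG. Qed.

Variables (K a : R).
Hypothesis K0 : 0 < K.
Hypothesis varY : forall s t : R, 0 <= s -> s <= t -> t - s <= 1 ->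
  0 <= mbm_cov H t t - 2 * mbm_cov H t s + mbm_cov H s s <= (K * (1 + s) * (t - s) `^ a) ^+ 2.

(* Borel-Cantelli: up to time [L * m], the [L * m * 2 ^ m] increments of level [m]
   have standard deviation [O(m * 2 ^ (- a m))], negligible with respect to [q ^ m]. *)
Lemma mbm_dyadic_increments (L : nat) (q : R) : 2^-1 `^ a < q ->
  {ae P, forall w, exists m0, dyadic_increments L m0 q (Y ^~ w)}.
Proof.
set p0 := 2^-1 `^ a => p0q.
have p00 : 0 < p0 by rewrite powR_gt0// invr_gt0.
have q0 : 0 < q by exact: lt_trans p0q.
pose inc m i w := Y (i.+1%:R * 2^-1 ^+ m) w - Y (i%:R * 2^-1 ^+ m) w.
pose E m i := inc m i @^-1` [set x | q ^+ m < `|x|].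
have mA l : measurable [set x : R | l < `|x|].
  have -> : [set x : R | l < `|x|] = setT `&` (@Num.norm R R) @^-1` `]l, +oo[%classic.
    by rewrite setTI; apply/seteqP; split => x; rewrite /= in_itv/= andbT.
  by apply: normr_measurable => //; exact: measurable_itv.
have mE m i : measurable (E m i).
  by rewrite -[E m i]setTI; apply: measurable_funB => //; exact: mA.
(* The intermediate rate [p1] absorbs the linear factor [1 + L m] of the standard deviation while
   staying below [q]; Bernoulli's inequality gives the constant. *)
pose p1 := (p0 + q) / 2.
have p01 : p0 < p1 by rewrite /p1; lra.
have p1q : p1 < q by rewrite /p1; lra.
have p10 : 0 < p1 by exact: lt_trans p01.
pose b := p1 / p0 - 1.
have b0 : 0 < b by rewrite subr_gt0 ltr_pdivlMr// mul1r.
pose C := K * (1 + L%:R / b).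
have C0 : 0 < C by rewrite mulr_gt0// ltr_wpDr// divr_ge0// ltW.
have lin m : 1 + L%:R * m%:R <= (1 + L%:R / b) * (p1 / p0) ^+ m.
  have hb : 1 + m%:R * b <= (p1 / p0) ^+ m.
    elim: m => [|m IH]; first by rewrite mul0r addr0 expr0.
    have p1p0 : p1 / p0 = 1 + b by rewrite /b; ring.
    rewrite exprSr -natr1; apply: (@le_trans _ _ ((1 + m%:R * b) * (1 + b))).
      have : 0 <= m%:R * b * b by rewrite !mulr_ge0// ltW.
      by lra.
    by rewrite p1p0 in IH *; rewrite ler_pM2r// ltr_wpDl.
  apply: (@le_trans _ _ ((1 + L%:R / b) * (1 + m%:R * b))).
    have -> : (1 + L%:R / b) * (1 + m%:R * b) = 1 + L%:R * m%:R + (m%:R * b + L%:R / b).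
      by field; rewrite gt_eqF.
    by rewrite lerDl addr_ge0//; [rewrite mulr_ge0// ltW|rewrite divr_ge0// ltW].
  by rewrite ler_wpM2l// addr_ge0// divr_ge0// ltW.
pose r := (p1 / q) ^+ 2.
have r01 : 0 <= r < 1.
  have pq0 : 0 <= p1 / q by rewrite divr_ge0// ltW.
  have pq1 : p1 / q < 1 by rewrite ltr_pdivrMr// mul1r.
  by rewrite /r sqr_ge0/= exprn_ilt1.
(* The rate [1/8] anticipates the union bound: level [m] has at most [L 4^m] increments, which
   leaves the summable [2^-m]. *)
have e8 : 0 < (8^-1 : R) by rewrite invr_gt0.
have [k hk] := exprn_small r01 e8.
have {hk} rk : r ^+ k <= 8^-1 by exact: hk.
pose B := Num.sqrt 2 * (4 * k%:R * C ^+ 2) ^+ k.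
have B0 : 0 <= B by rewrite mulr_ge0// exprn_ge0// mulr_ge0 ?sqr_ge0// mulr_ge0.
have PE m i : (i < L * m * 2 ^ m)%N -> (P (E m i) <= (B * 8^-1 ^+ m)%:E)%E.
  move=> iN; have h0 : (0 : R) < 2^-1 ^+ m by rewrite exprn_gt0// invr_gt0.
  have s0 : 0 <= i%:R * 2^-1 ^+ m :> R by rewrite mulr_ge0// ltW.
  have dt : i.+1%:R * 2^-1 ^+ m - i%:R * 2^-1 ^+ m = 2^-1 ^+ m :> R.
    by rewrite -mulrBl -natr1 [_ + 1]addrC addrK mul1r.
  have st : i%:R * 2^-1 ^+ m <= i.+1%:R * 2^-1 ^+ m :> R by rewrite ler_pM2r// ler_nat.
  have t0 := le_trans s0 st.
  have dt1 : i.+1%:R * 2^-1 ^+ m - i%:R * 2^-1 ^+ m <= 1 :> R.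
    by rewrite dt; apply: exprn_ile1; lra.
  have /andP[v0 vle] := varY s0 st dt1.
  rewrite /E /inc mbm_increment_law//.
  have sle : i%:R * 2^-1 ^+ m <= L%:R * m%:R :> R.
    rewrite -natrM exprVn ler_pdivrMr ?exprn_gt0// -natrX -natrM ler_nat; exact: ltnW.
  have pw : (2^-1 ^+ m : R) `^ a = p0 ^+ m.
    by rewrite powR_exprn ?invr_ge0.
  have vs : mbm_cov H (i.+1%:R * 2^-1 ^+ m) (i.+1%:R * 2^-1 ^+ m) -
      2 * mbm_cov H (i.+1%:R * 2^-1 ^+ m) (i%:R * 2^-1 ^+ m) +
      mbm_cov H (i%:R * 2^-1 ^+ m) (i%:R * 2^-1 ^+ m) <= (C * p1 ^+ m) ^+ 2.
    apply: (le_trans vle); rewrite dt pw.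
    have pm0 : 0 <= p0 ^+ m by rewrite exprn_ge0// ltW.
    have n1 : 0 <= K * (1 + i%:R * 2^-1 ^+ m) * p0 ^+ m.
      by rewrite !mulr_ge0 ?(ltW K0)// addr_ge0.
    have n2 : 0 <= C * p1 ^+ m by rewrite mulr_ge0 ?exprn_ge0// ltW.
    rewrite lerXn2r// /C -!mulrA ler_pM2l//.
    apply: (@le_trans _ _ ((1 + L%:R * m%:R) * p0 ^+ m)); first by rewrite ler_wpM2r// lerD2l.
    apply: (le_trans (ler_wpM2r pm0 (lin m))).
    by rewrite -mulrA -exprMn divfK// gt_eqF.
  have := centered_gaussian_tail_pow k v0 vs (mulr_gt0 C0 (exprn_gt0 m p10)) (exprn_gt0 m q0).
  move=> /le_trans; apply; rewrite lee_fin.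
  have -> : (4 * k%:R * (C * p1 ^+ m / q ^+ m) ^+ 2) ^+ k = (4 * k%:R * C ^+ 2) ^+ k * (r ^+ k) ^+ m.
    rewrite -exprM [(k * m)%N]mulnC exprM -exprMn; congr (_ ^+ k).
    have -> : r ^+ m = (p1 ^+ m / q ^+ m) ^+ 2 by rewrite /r -expr_div_n -!exprM mulnC.
    by rewrite -[C * _ / _]mulrA; ring.
  rewrite mulrA -/B ler_wpM2l// lerXn2r ?nnegrE ?invr_ge0// exprn_ge0//.
  by case/andP: r01.
pose bad m := \big[setU/set0]_(i < L * m * 2 ^ m) E m i.
have mbad m : measurable (bad m) by apply: bigsetU_measurable => i _.
have Pbad m : (P (bad m) <= (L%:R * B * 2^-1 ^+ m)%:E)%E.
  apply: le_trans; first exact: le_mu_bigsetU.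
  apply: (@le_trans _ _ (\sum_(i < L * m * 2 ^ m) (B * 8^-1 ^+ m)%:E)%E).
    by apply: lee_sum => i _; exact: PE.
  rewrite sumEFin lee_fin sumr_const card_ord -[_ *+ _]mulr_natr !natrM natrX.
  have m2 : m%:R <= 2 ^+ m :> R by rewrite -natrX ler_nat ltnW// ltn_expl.
  have e8m : 8^-1 ^+ m = (2^-1 ^+ m) * (2^-1 ^+ m) * (2^-1 ^+ m) :> R.
    by rewrite -!exprMn; congr (_ ^+ m); field.
  have e1 : 2 ^+ m * 2^-1 ^+ m = 1 :> R by rewrite -exprMn mulfV ?pnatr_eq0// expr1n.
  have h0 : (0 : R) < 2^-1 ^+ m by rewrite exprn_gt0// invr_gt0.
  apply: (@le_trans _ _ (B * 8^-1 ^+ m * (L%:R * 2 ^+ m * 2 ^+ m))).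
    apply: ler_wpM2l; first by rewrite mulr_ge0// exprn_ge0// invr_ge0.
    apply: ler_wpM2r; first by rewrite exprn_ge0.
    by rewrite ler_wpM2l.
  rewrite e8m le_eqVlt; apply/orP; left; apply/eqP.
  transitivity (L%:R * B * 2^-1 ^+ m * (2 ^+ m * 2^-1 ^+ m) * (2 ^+ m * 2^-1 ^+ m)).
    by ring.
  by rewrite e1 !mulr1.
have PL0 : P (lim_sup_set bad) = 0.
  apply: lim_sup_set_cvg0 => //.
  apply: (@le_lt_trans _ _ (\sum_(0 <= m <oo) (L%:R * B * 2^-1 ^+ m)%:E)%E).
    by apply: lee_nneseries => // m _; exact: Pbad.
  apply: nneseries_geometric_lty; first by rewrite mulr_ge0.
  by rewrite invr_ge0 ler0n/= invf_lt1// ltr1n.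
exists (lim_sup_set bad); split=> //.
  by apply: bigcapT_measurable => n; apply: bigcup_measurable => j _; exact: mbad.
move=> w /= nL n _; apply: contrapT => nj; apply: nL; exists n => m i nm iN.
rewrite leNgt; apply/negP => h; apply: nj; exists m => //.
by rewrite /bad -bigcup_mkord; exists i.
Qed.

End mbm_paths.

(** * Almost sure non-vanishing of the limit *)

Section langevin_nonvanishing.
Context {R : realType} {d} {Omega : measurableType d} (P : probability Omega R).
Variables (H : R -> R) (Y : R -> Omega -> R) (theta x0 k : R).
Hypothesis YG : centered_gaussian_process P Y (mbm_cov H).
Hypothesis k0 : 0 < k.
Hypothesis H1 : forall t : R, 0 <= t -> H t <= 1.
Hypothesis theta0 : 0 < theta.
Hypothesis lower : forall n (t c : 'I_n -> R), (forall i, 0 <= t i) ->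
  (forall i, H (t i) <= 1) -> (forall i, 0 <= c i) ->
  k * (\sum_(i < n | 2^-1 <= t i <= 1) c i) ^+ 2 <=
  \sum_(i < n) \sum_(j < n) c i * c j * mbm_cov H (t i) (t j).

Let mY t : measurable_fun setT (Y t). Proof. by have [] := YG. Qed.

Let time (n i : nat) : R := i%:R * 2^-1 ^+ n.
Let coef (n i : nat) : R := expR (- theta * time n i) * 2^-1 ^+ n.

Let S (T n : nat) (w : Omega) : R :=
  \sum_(i < T * 2 ^ n) expR (- theta * time n i) * (x0 + Y (time n i) w) * 2^-1 ^+ n.

Let time_ge0 n i : 0 <= time n i.
Proof. by rewrite mulr_ge0// exprn_ge0// invr_ge0. Qed.

Let coef_ge0 n i : 0 <= coef n i.
Proof. by rewrite mulr_ge0 ?expR_ge0// exprn_ge0// invr_ge0. Qed.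

Let S_E T n : S T n = (fun w => \sum_(i < T * 2 ^ n) coef n i * x0 +
  \sum_(i < T * 2 ^ n) coef n i * Y (time n i) w).
Proof.
apply/funext => w; rewrite -big_split/=; apply: eq_bigr => i _.
by rewrite /coef; ring.
Qed.

Let mS T n : measurable_fun setT (S T n).
Proof.
rewrite S_E; apply: measurable_funD => //; apply: measurable_sum => i.
by apply: measurable_funM.
Qed.

(** The [2^n] indices with [2^n <= i < 2^(n+1)] have times in [[1/2, 1)], and each carries a weight
    at least [exp (- theta) 2^-(n+1)]. *)
Let sum_coef T n : expR (- theta) / 2 <=
  \sum_(i < T.+1 * 2 ^ n.+1 | 2^-1 <= time n.+1 i <= 1) coef n.+1 i.
Proof.
have h0 : (0 : R) < 2^-1 ^+ n.+1 by rewrite exprn_gt0// invr_gt0.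
have e1 : 2 ^+ n.+1 * 2^-1 ^+ n.+1 = 1 :> R by rewrite -exprMn mulfV ?pnatr_eq0// expr1n.
pose N := (T.+1 * 2 ^ n.+1)%N.
have NN : (2 ^ n.+1 <= N)%N by rewrite /N leq_pmull.
apply: (@le_trans _ _ (\sum_(i < N | (2 ^ n <= i)%N && (i < 2 ^ n.+1)%N) expR (- theta) * 2^-1 ^+ n.+1)).
  rewrite -(big_mkord (fun i => (2 ^ n <= i)%N && (i < 2 ^ n.+1)%N) (fun=> expR (- theta) * 2^-1 ^+ n.+1)).
  rewrite -(big_nat_widen 0 (2 ^ n.+1) N (fun i => 2 ^ n <= i)%N)//.
  rewrite (_ : \sum_(0 <= i < 2 ^ n.+1 | (2 ^ n <= i)%N) _ = \sum_(2 ^ n <= i < 2 ^ n.+1) expR (- theta) * 2^-1 ^+ n.+1); last first.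
    by rewrite (big_nat_widenl (2 ^ n) 0).
  have -> : \sum_(2 ^ n <= i < 2 ^ n.+1) expR (- theta) * 2^-1 ^+ n.+1 =
      expR (- theta) * 2^-1 ^+ n.+1 * 2 ^+ n.
    by rewrite sumr_const_nat expnS mul2n -addnn addnK -natrX mulr_natr.
  have e2 : 2 ^+ n * 2^-1 ^+ n.+1 = 2^-1 :> R by rewrite exprS mulrCA -exprMn mulfV ?pnatr_eq0// expr1n mulr1.
  by rewrite -mulrA [_ * 2 ^+ n]mulrC e2.
rewrite big_mkcond [leRHS]big_mkcond/=; apply: ler_sum => i _.
case: ifP => [/andP[i1 i2]|_]; last by case: ifP.
have t2 : time n.+1 i <= 1.
  rewrite -e1 /time ler_pM2r// -natrX ler_nat; exact: ltnW.
have -> : 2^-1 <= time n.+1 i.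
  have -> : (2^-1 : R) = 2 ^+ n * 2^-1 ^+ n.+1.
    by rewrite exprS mulrCA -exprMn mulfV ?pnatr_eq0// expr1n mulr1.
  by rewrite /time ler_pM2r// -natrX ler_nat.
rewrite t2 /= /coef ler_pM2r// ler_expR -[leLHS]mulr1 ler_wnM2l// oppr_le0.
exact: ltW.
Qed.

Let C := 2 / Num.sqrt (k * (expR (- theta) / 2) ^+ 2).

(** [lower] and [sum_coef] bound the variance from below by a constant free of [T] and [n], so [C]
    is uniform in both. *)
Let small_ball T n (e : R) : 0 < e ->
  (P (S T.+1 n.+1 @^-1` [set x : R | (`|x| < e)%R]) <= (C * e)%:E)%E.
Proof.
move=> e0; pose N := (T.+1 * 2 ^ n.+1)%N; have [_ law] := YG.
set c := \sum_(i < N) coef n.+1 i * x0.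
have -> : S T.+1 n.+1 @^-1` [set x | `|x| < e] =
   (fun w => \sum_(i < N) coef n.+1 i * Y (time n.+1 i) w) @^-1` [set x | `|c + x| < e].
  by rewrite S_E.
have mA : measurable [set x : R | `|c + x| < e].
  have -> : [set x : R | `|c + x| < e] = `]- c - e, - c + e[%classic.
    by apply/seteqP; split => x; rewrite /= in_itv/= ltr_norml => /andP[h1 h2]; apply/andP; split; lra.
  exact: measurable_itv.
rewrite (law N (fun i : 'I_N => time n.+1 i) (fun i : 'I_N => coef n.+1 i))//.
have ks0 : 0 < k * (expR (- theta) / 2) ^+ 2.
  by rewrite mulr_gt0// exprn_gt0// divr_gt0// expR_gt0.
have -> : (C * e) = 2 * e / Num.sqrt (k * (expR (- theta) / 2) ^+ 2) by rewrite /C; ring.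
apply: centered_gaussian_small_ball => //.
apply: le_trans (@lower N (fun i : 'I_N => time n.+1 i) (fun i : 'I_N => coef n.+1 i) _ _ _) => //.
  2: by move=> i; exact: H1.
rewrite ler_pM2l// lerXn2r ?nnegrE ?divr_ge0 ?expR_ge0//; last exact: sum_coef.
by apply: sumr_ge0 => i _.
Qed.

(** Expresses, through measurable sums only, that the limit in [n] then in [T] is not zero. For each
    [e], the negated event lies in a double inferior limit of probability at most [C e]; then [e]
    runs through [1 / (j + 1)]. *)
Lemma langevin_limit_neq0 : {ae P, forall w, ~ forall e : R, 0 < e ->
  exists T0, forall T, (T0 <= T)%N -> exists n0, forall n, (n0 <= n)%N -> `|S T n w| < e}.
Proof.
(* The shifts guarantee a horizon of at least [1] and a level at which [1/2] is a dyadic time, as in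
   [sum_coef]. *)
pose A (e : R) T n := S T.+1 n.+1 @^-1` [set x | `|x| < e].
pose B (e : R) T := \bigcup_N \bigcap_(n >= N) A e T n.
pose D (e : R) := \bigcup_N \bigcap_(T >= N) B e T.
have mA e T n : measurable (A e T n).
  have mball : measurable [set x : R | `|x| < e].
    have -> : [set x : R | `|x| < e] = `]- e, e[%classic.
      by apply/seteqP; split => x; rewrite /= in_itv/= ltr_norml.
    exact: measurable_itv.
  by rewrite -[A e T n]setTI; exact: mS.
have hB e T : 0 < e -> measurable (B e T) /\ (P (B e T) <= (C * e)%:E)%E.
  by move=> e0; apply: probability_liminf_le => // n; exact: small_ball.
have hD e : 0 < e -> measurable (D e) /\ (P (D e) <= (C * e)%:E)%E.
  by move=> e0; apply: probability_liminf_le => T; [exact: (hB e T e0).1|exact: (hB e T e0).2].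
have einv (j : nat) : 0 < j.+1%:R^-1 :> R by rewrite invr_gt0.
have mN : measurable (\bigcap_j D j.+1%:R^-1).
  by apply: bigcapT_measurable => j; exact: (hD _ (einv j)).1.
have C0 : 0 <= C by rewrite divr_ge0.
exists (\bigcap_j D j.+1%:R^-1); split=> //.
  apply/eqP; rewrite eq_le measure_ge0 andbT; apply/lee_addgt0Pr => e e0; rewrite add0e.
  have [j Cj] : exists j : nat, C / e < j.+1%:R.
    exists (Num.truncn (C / e)).
    by have /andP[] := truncn_itv (divr_ge0 C0 (ltW e0)).
  apply: (@le_trans _ _ (P (D j.+1%:R^-1))).
    apply: le_measure; rewrite ?inE//; first exact: (hD _ (einv j)).1.
    by move=> w; apply.
  apply: (le_trans (hD _ (einv j)).2); rewrite lee_fin ler_pdivrMr// mulrC.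
  by move: Cj; rewrite ltr_pdivrMr// => /ltW.
move=> w /= /contrapT Sw j _; have [T0 hT] := Sw _ (einv j).
exists T0 => // T /= T0T; have [n0 hn] := hT T.+1 (leqW T0T).
by exists n0 => // n /= n0n; apply: hn; exact: leqW.
Qed.

End langevin_nonvanishing.

(** Extends the estimate to [s = 0]: [H 0] is approximated by [H u] for small [u > 0], and
    [(t - u)^kappa <= t^kappa]. *)
Lemma holder_at0 {R : realType} (H : R -> R) (D kappa : R) :
  {within `[0, +oo[, continuous H} -> 0 <= D -> 0 <= kappa ->
  (forall t s, 0 < s -> s <= t -> `|H t - H s| <= D * (t - s) `^ kappa) ->
  forall t s, 0 <= s -> s <= t -> `|H t - H s| <= D * (t - s) `^ kappa.
Proof.
move=> cH D0 k0 HD t s; rewrite le_eqVlt => /predU1P[<-|s0]; last exact: HD.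
rewrite le_eqVlt => /predU1P[<-|t0].
  by rewrite subrr normr0 mulr_ge0// powR_ge0.
apply/ler_addgt0Pr => e e0.
have [d d0 hd] := within_continuous_dist cH (lexx 0) e0.
pose u := Num.min (d / 2) t.
have u0 : 0 < u by rewrite lt_min t0 divr_gt0.
have ut : u <= t by rewrite ge_min lexx orbT.
have ud : u < d by rewrite gt_min; apply/orP; left; lra.
have h1 := hd u (ltW u0); rewrite subr0 gtr0_norm// in h1.
have {h1} h1 := h1 ud; have h2 := HD t u u0 ut.
have -> : H t - H 0 = (H t - H u) + (H u - H 0) by ring.
apply: (le_trans (ler_normD _ _)); apply: lerD => //; apply: (le_trans h2).
rewrite ler_wpM2l// ge0_ler_powR ?nnegrE ?subr_ge0 ?(ltW t0)//.
by rewrite lerB// ltW.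
Qed.

(** * Strong consistency of the estimator *)

Unset Implicit Arguments.

Theorem theorem11 (R : realType) (d : measure_display) (Omega : measurableType d)
  (P : probability Omega R) (H : R -> R) (h1 h2 D kappa : R)
  (x0 theta : R) (Y X : R -> Omega -> R) :
  {within `[0, +oo[, continuous H} ->
  (forall t, 0 <= t -> 0 < H t < 1) ->
  0 < h1 -> h1 < h2 -> h2 < 1 ->
  (forall t, 0 <= t -> h1 <= H t <= h2) ->
  0 < D -> 0 < kappa <= 1 ->
  (forall t s, 0 < s -> s <= t -> `|H t - H s| <= D * (t - s) `^ kappa) ->
  2^-1 < h1 -> 2^-1 < kappa ->
  0 < theta ->
  is_mbm P H Y ->
  {ae P, forall w,
     {within `[0, +oo[, continuous (fun t => X t w)} /\
     forall t, 0 <= t ->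
       X t w = x0 + theta * Rintegral lebesgue_measure `[0, t] (fun s => X s w) + Y t w} ->
  {ae P, forall w, exists I : R -> R,
     (forall T, 0 < T -> is_RS_integral (fun s => X s w) (fun s => X s w) 0 T (I T)) /\
     (fun T => I T / Rintegral lebesgue_measure `[0, T] (fun s => X s w ^+ 2))
        @ +oo --> theta}.
Proof.
move=> cH H01 h1_gt0 h12 h2_lt1 Hh D0 /andP[kappa0 kappa1] HD h1_half kappa_half theta0 [YG cY] solX.
(* [a] is the midpoint of [1/2] and [min h1 kappa]: the first bound serves the quadratic variation,
   the second the variance of increments. *)
pose m := Num.min h1 kappa; pose a := (2^-1 + m) / 2.
have m_half : 2^-1 < m by rewrite lt_min h1_half kappa_half.
have a_half : 2^-1 < a by rewrite /a; lra.
have am : a < m by rewrite /a; lra.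
have ah1 : a < h1 by apply: (lt_le_trans am); rewrite ge_min lexx.
have ak : a <= kappa by apply: (le_trans (ltW am)); rewrite ge_min lexx orbT.
have a1 : a <= 1 by exact: le_trans kappa1.
have h20 : 0 < h2 by exact: lt_trans h12.
have HD0 := holder_at0 cH (ltW D0) (ltW kappa0) HD.
have [K K0 varY] := mbm_increment_variance ah1 h2_lt1 h20 a_half ak a1 D0 Hh HD0.
have [k k0 lower] := mbm_variance_lower ah1 h2_lt1 h20 a_half Hh.
pose p0 : R := 2^-1 `^ a.
have p00 : 0 < p0 by rewrite powR_gt0// invr_gt0.
have p02 : p0 ^+ 2 < 2^-1.
  rewrite -powR_mulrn ?(ltW p00)// -powRrM.
  have half0 : (0 : R) < 2^-1 by rewrite invr_gt0.
  rewrite /powR gt_eqF// -[ltRHS]lnK ?posrE// ltr_expR.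
  have l0 : ln (2^-1 : R) < 0 by rewrite ln_lt0// half0/= invf_lt1// ltr1n.
  by rewrite -[ltRHS]mul1r ltr_nM2r//; lra.
(* [q^2] is the midpoint of [2^(- 2 a)] and [1/2], whence [2^-a < q] and [2 q^2 < 1]. *)
pose q := Num.sqrt ((p0 ^+ 2 + 2^-1) / 2).
have q2 : q ^+ 2 = (p0 ^+ 2 + 2^-1) / 2.
  by rewrite sqr_sqrtr// divr_ge0// addr_ge0 ?sqr_ge0// invr_ge0.
have q0 : 0 <= q by rewrite sqrtr_ge0.
have p0q : p0 < q by rewrite -(@ltr_pXn2r _ 2)// ?nnegrE ?(ltW p00)// q2; lra.
have q_half : 2^-1 <= q.
  rewrite -(@ler_pXn2r _ 2)// ?nnegrE ?invr_ge0// q2.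
  by have := sqr_ge0 p0; lra.
have q21 : 2 * q ^+ 2 < 1 by rewrite q2; lra.
have q1 : q < 1 by rewrite -(@ltr_pXn2r _ 2)// ?nnegrE// expr1n; lra.
(* [L > 6 / theta] gives [theta L / 2 > 3], hence [exp (theta L / 2) >= 1 + 3 = 4], as the growth
   estimate demands. *)
pose L := (Num.truncn (6 / theta)).+1.
have L0 : (0 < L)%N by [].
have L4 : 4 <= expR (theta / 2 * L%:R).
  have /andP[_ hL] : _ <= 6 / theta < L%:R := truncn_itv (divr_ge0 (ler0n _ 6) (ltW theta0)).
  apply: le_trans (expR_ge1Dx _).
  by move: hL; rewrite ltr_pdivrMr//; lra.
have H1 (t : R) : 0 <= t -> H t <= 1 by move=> /H01/andP[_ /ltW].
have incr := mbm_dyadic_increments YG K0 varY L p0q.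
have nz := langevin_limit_neq0 x0 YG k0 H1 theta0 lower.
have aeF := ae_filter_ringOfSetsType P.
apply: filterS (filterI (filterI cY solX) (filterI incr nz)) => w [[cYw [cXw Xw]] [[m0 incw] nzw]].
have mod_w := dyadic_increments_modulus L0 q0 q1 cYw incw.
have [G Gw] := dyadic_increments_growth L0 q0 q1 cYw incw L4.
have [l Vl] := langevin_is_cvg theta0 cXw Gw Xw.
have [l0|l0] := eqVneq l 0; last first.
  exact: (langevin_estimator theta0 q_half q21 cXw mod_w Gw Xw l0 Vl).
(* If [l = 0], the discounted integral is small at large integer times, and so are the dyadic sums
   converging to it, contrary to the almost sure non-vanishing. *)
exfalso; apply: nzw => e e0; have e20 : 0 < e / 2 by rewrite divr_gt0.
have [M M0 hM] := (cvgryP _ _).1 Vl _ e20.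
exists (Num.truncn M).+1 => T MT.
have hT : `|expR (- theta * T%:R) * Rintegral lebesgue_measure `[0, T%:R] (fun s => X s w) - l| <= e / 2.
  apply: hM; have /andP[_ /ltW h] := truncn_itv M0; apply: (le_trans h).
  by rewrite ler_nat.
have := langevin_dyadic_sum (T := T) q_half q21 cXw cYw mod_w Xw.
move=> /cvgrPdist_lt/(_ _ e20)[n0 _ hn]; exists n0 => n nn0.
have := hn n nn0; move: hT; rewrite l0 subr0.
set V := expR _ * _; set S := \sum_(i < _) _ => hV VS.
have -> : S = V - (V - S) by ring.
by apply: (le_lt_trans (ler_normB _ _)); lra.
Qed.
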